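(* Fix $\delta\in(0,2)$. Let $\gamma=\gamma_\delta$ be the slab density $\gamma(x)=c_\gamma(1+|x|)^{-1-\delta}$, let $\hat\alpha$ be the corresponding marginal maximum likelihood estimator, and suppose that $s=o(n)$, $s\to\infty$ and that for some constant $\kappa_1>0$ we have $\kappa_1\log^2 n\le s$. Then there exists a universal constant $C>0$, in particular independent of $\delta$ and $q$, such that, for large enough $n$, for any $q\in(2\delta,2]$, $$\sup_{\theta_0\in \ell_0[s]} E_{\theta_0}\int d_q(\theta,\theta_0)\,d\Pi_{\hat\alpha}(\theta\mid X)\le C s\log^{q/2}(n/s).$$
   Context: Model: one observes $X=(X_1,\dots,X_n)$ with $X_i=\theta_i+\varepsilon_i$, $\varepsilon_i$ i.i.d. $N(0,1)$, $\theta\in\mathbb R^n$; $P_\theta$, $E_\theta$ denote the law of $X$ and its expectation. For a sequence $s=s_n$, $\ell_0[s]=\{\theta\in\mathbb R^n: |\{i:\theta_i\ne0\}|\le s\}$. For $0<q\le2$, $d_q(\theta,\theta')=\sum_{i=1}^n|\theta_i-\theta_i'|^q$. Prior and posterior: $\phi$ is the standard normal density; $\gamma(x)=c_\gamma(1+|x|)^{-1-\delta}$ with $c_\gamma$ the normalising constant; $g=\phi*\gamma$. For $\alpha\in[0,1]$ the spike and slab prior is $\Pi_\alpha=\otimes_{i=1}^n((1-\alpha)\delta_0+\alpha G)$, where $G$ has density $\gamma$ and $\delta_0$ is the Dirac mass at $0$. The posterior is $\Pi_\alpha[\cdot\mid X]=\otimes_{i=1}^n\big((1-a_\alpha(X_i))\delta_0+a_\alpha(X_i)\gamma_{X_i}(\cdot)\big)$,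 where $\gamma_x(u)=\phi(x-u)\gamma(u)/g(x)$ and $a_\alpha(x)=\alpha g(x)/\{(1-\alpha)\phi(x)+\alpha g(x)\}$. $\Pi_{\hat\alpha}[\cdot\mid X]$ is this posterior with $\alpha$ replaced by $\hat\alpha=\hat\alpha(X)$. Let $\hat\theta_\alpha$ be the vector of coordinatewise posterior medians; there is a threshold $t(\alpha)>0$ with $(\hat\theta_\alpha)_i=0$ if and only if $|X_i|\le t(\alpha)$. Let $\alpha_n$ be defined by $t(\alpha_n)=\sqrt{2\log n}$. The marginal maximum likelihood estimator is $\hat\alpha=\operatorname{argmax}_{\alpha\in[\alpha_n,1]}\sum_{i=1}^n\log\big((1-\alpha)\phi(X_i)+\alpha g(X_i)\big)$. *)

(* Defs.v *)
From HB Require Import structures.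
From mathcomp Require Import all_boot all_order all_algebra.
From mathcomp Require Import all_classical all_reals all_analysis.
From mathcomp Require Import measurable_realfun.

Set Implicit Arguments.
Unset Strict Implicit.
Unset Printing Implicit Defensive.

Import Order.TTheory GRing.Theory Num.Theory.
Import numFieldNormedType.Exports.

Local Open Scope classical_set_scope.
Local Open Scope ring_scope.

(* R itself carries another measurable structure than measurableTypeR R, the one
   on which lebesgue_measure and normal_prob live; the two sigma-algebras agree. *)
Notation vec R n := (n.-tuple (measurableTypeR R)).

Section product_of_probabilities.
Context {R : realType}.

Definition tuple_cons n (z : measurableTypeR R * vec R n) : vec R n.+1 :=
  [tuple of z.1 :: z.2].

Lemma measurable_tuple_cons n : measurable_fun setT (@tuple_cons n).
Proof. exact: measurable_cons. Qed.

HB.instance Definition _ n := isMeasurableFun.Build _ _ _ _ (@tuple_cons n)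
  (@measurable_tuple_cons n).

Fixpoint product_prob n : ('I_n -> probability (measurableTypeR R) R) ->
    probability (vec R n) R :=
  match n with
  | 0 => fun=> \d_([tuple] : vec R 0)
  | m.+1 => fun P => distribution
      (P ord0 \x product_prob (fun i => P (lift ord0 i)))%E
      (@tuple_cons m)
  end.

End product_of_probabilities.

Section model.
Context {R : realType}.

Definition noise n : probability (vec R n) R :=
  @product_prob R n (fun=> normal_prob 0 1).

Definition observation n (theta eps : vec R n) : vec R n :=
  [tuple (tnth theta i + tnth eps i : R) | i < n].

Lemma measurable_observation n (theta : vec R n) :
  measurable_fun setT (observation theta).
Proof.
apply/measurable_fun_tnthP => i.
rewrite (_ : _ \o _ = fun eps => (tnth theta i : R) + (tnth eps i : R)); last first.
  by apply/funext => eps /=; rewrite tnth_mktuple.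
by apply: measurable_funD => //; exact: measurable_tnth.
Qed.

HB.instance Definition _ n (theta : vec R n) :=
  isMeasurableFun.Build _ _ _ _ (observation theta)
    (measurable_observation theta).

Definition law_of_X n (theta : vec R n) : probability (vec R n) R :=
  distribution (noise n) (observation theta).

Definition sparse n (s : R) : set (vec R n) :=
  [set theta | (#|[set i | (tnth theta i : R) != 0]%SET|)%:R <= s].

Definition dq n (q : R) (theta theta' : vec R n) : R :=
  \sum_(i < n) `|(tnth theta i : R) - (tnth theta' i : R)| `^ q.

End model.
Arguments sparse {R} n s.

Section spike_and_slab.
Context {R : realType}.
Context (delta : R).
Local Notation mu := (@lebesgue_measure R).

Definition phi (x : R) : R := normal_pdf 0 1 x.

Definition slab_shape (x : R) : R := (1 + `|x|) `^ (- 1 - delta).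

Definition slab_const : R := (\int[mu]_x slab_shape x)^-1.

Definition slab (x : R) : R := slab_const * slab_shape x.

Definition marginal (x : R) : R := \int[mu]_u (phi (x - u) * slab u).

Definition slab_post (x u : R) : R := phi (x - u) * slab u / marginal x.

Definition slab_weight (alpha x : R) : R :=
  alpha * marginal x / ((1 - alpha) * phi x + alpha * marginal x).

Lemma slab_shape_arg_gt0 (x : R) : 0 < 1 + `|x|.
Proof. by rewrite ltr_pwDl. Qed.

Lemma continuous_slab_shape : continuous slab_shape.
Proof.
move=> x; apply: (@continuous_comp _ _ _ (fun x : R => 1 + `|x|)
  (fun y : R => y `^ (- 1 - delta))).
  by apply: cvgD; [exact: cvg_cst|exact: norm_continuous].
apply: differentiable_continuous; apply/derivable1_diffP.
by apply: derivable_powR; rewrite in_itv/= slab_shape_arg_gt0.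
Qed.

Lemma integral_slab_shape : 0 < delta ->
  (\int[mu]_x (slab_shape x)%:E = (2 / delta)%:E)%E.
Proof.
move=> d0.
rewrite ge0_symfun_integralT//; last 3 first.
- by move=> x; exact: powR_ge0.
- exact: continuous_slab_shape.
- by move=> x /=; rewrite /slab_shape normrN.
rewrite -set_itvcy.
pose F (x : R) : R := - delta^-1 * (1 + x) `^ (- delta).
have dF (x : R) : 0 <= x ->
    is_derive x 1 F ((1 + x) `^ (- 1 - delta)).
  move=> x0; have x1 : 0 < 1 + x by rewrite ltr_pwDl.
  have H : is_derive x 1 (fun x : R => 1 + x) 1.
    rewrite -[X in is_derive _ _ _ X]add0r.
    exact: (is_deriveD (is_derive_cst _ _ _) (is_derive_id _ _)).
  have -> : (1 + x) `^ (- 1 - delta) =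
      - delta^-1 *: ((- delta * (1 + x) `^ (- delta - 1)) * 1).
    rewrite /GRing.scale/= mulr1 mulrA mulrNN mulVf ?gt_eqF// mul1r.
    by rewrite [- 1 - delta]addrC.
  exact: (is_deriveZ (- delta^-1)
    (is_derive1_comp (is_derive1_powR (- delta) x1) H)).
rewrite (@ge0_continuous_FTC2y _ _ F _ 0).
- by rewrite /F addr0 powR1 mulr1 EFinN sub0e oppeK -EFinM.
- by move=> x _; exact: powR_ge0.
- exact/continuous_subspaceT/continuous_slab_shape.
- rewrite -[X in _ --> X](mulr0 (- delta^-1)); apply: cvgM; first exact: cvg_cst.
  apply: (@cvg_trans _ ((fun x : R => expR (- (delta * ln (1 + x)))) @ +oo)).
    apply: near_eq_cvg; near=> x.
    rewrite /powR gt_eqF ?mulNr//.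
    by rewrite ltr_pwDl//; near: x; exact: nbhs_pinfty_ge.
  apply: (@cvg_comp _ _ _ (fun x : R => delta * ln (1 + x))
    (fun y : R => expR (- y))); last exact: cvgr_expR.
  apply: gt0_cvgMry => //; apply/cvgryPge => A.
  near=> x.
  have ex : expR A <= x by near: x; exact: nbhs_pinfty_ge.
  rewrite -[A]expRK ler_ln ?posrE ?expR_gt0//.
    by rewrite (le_trans ex)// lerDr.
  by rewrite (lt_le_trans (expR_gt0 A))// (le_trans ex)// lerDr.
- by move=> x /ltW x0; have [] := dF _ x0.
- apply: cvg_at_right_filter; apply: differentiable_continuous.
  by apply/derivable1_diffP; have [] := dF _ (lexx 0).
- move=> x; rewrite in_itv/= andbT => x0.
  have := dF _ (ltW x0) => -[_]; rewrite derive1E => ->.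
  by rewrite /slab_shape gtr0_norm.
Unshelve. all: by end_near. Qed.

Lemma slab_const_gt0 : 0 < delta -> 0 < slab_const.
Proof.
move=> d0.
by rewrite /slab_const /Rintegral integral_slab_shape//= invr_gt0 divr_gt0.
Qed.

Lemma measurable_slab_shape : measurable_fun setT slab_shape.
Proof.
by apply: continuous_measurable_fun; exact: continuous_slab_shape.
Qed.

Lemma measurable_slab : measurable_fun setT slab.
Proof. by apply: measurable_funM => //; exact: measurable_slab_shape. Qed.

Lemma slab_gt0 : 0 < delta -> forall x, 0 < slab x.
Proof.
move=> d0 x; rewrite mulr_gt0 ?slab_const_gt0//.
by rewrite powR_gt0// slab_shape_arg_gt0.
Qed.

Lemma phi_gt0 (x : R) : 0 < phi x.
Proof.
by rewrite /phi normal_pdfE ?oner_neq0// mulr_gt0 ?normal_peak_gt0 ?expR_gt0.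
Qed.

Lemma measurable_joint (x : R) :
  measurable_fun setT (fun u : R => phi (x - u) * slab u).
Proof.
apply: measurable_funM; last exact: measurable_slab.
apply: measurableT_comp; first exact: measurable_normal_pdf.
by apply: measurable_funB.
Qed.

Lemma integrable_slab : 0 < delta -> mu.-integrable setT (EFin \o slab).
Proof.
move=> d0.
have -> : EFin \o slab = fun x => (slab_const%:E * (slab_shape x)%:E)%E.
  by apply/funext => x; rewrite /= EFinM.
apply: integrableZl => //; apply/integrableP; split.
  by apply/measurable_EFinP; exact: measurable_slab_shape.
under eq_integral do rewrite /= ger0_norm ?powR_ge0//.
by rewrite integral_slab_shape// ltry.
Qed.

Lemma integrable_joint (x : R) : 0 < delta ->
  mu.-integrable setT (fun u : R => (phi (x - u) * slab u)%:E).
Proof.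
move=> d0.
apply: (@le_integrable _ _ _ mu setT measurableT _
  (fun u : R => ((normal_peak 1)%:E * (slab u)%:E)%E)).
- by apply/measurable_EFinP; exact: measurable_joint.
- move=> u _; rewrite -EFinM lee_fin !normrM ler_wpM2r//.
  rewrite ger0_norm ?(ltW (phi_gt0 _))// ger0_norm ?normal_peak_ge0//.
  by rewrite normal_pdf_ub// oner_neq0.
- by apply: integrableZl => //; exact: integrable_slab.
Qed.

Lemma marginalE (x : R) : 0 < delta ->
  (\int[mu]_u (phi (x - u) * slab u)%:E = (marginal x)%:E)%E.
Proof.
move=> d0; rewrite /marginal /Rintegral fineK//.
by apply: integrable_fin_num => //; exact: integrable_joint.
Qed.

Lemma marginal_gt0 (x : R) : 0 < delta -> 0 < marginal x.
Proof.
move=> d0.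
have joint_gt0 u : 0 < phi (x - u) * slab u by rewrite mulr_gt0 ?phi_gt0 ?slab_gt0.
rewrite lt_neqAle; apply/andP; split; last first.
  by apply: Rintegral_ge0 => u _; exact: ltW.
apply/negP => /eqP m0.
have : (\int[mu]_u `|(phi (x - u) * slab u)%:E| = 0)%E.
  under eq_integral do rewrite /= ger0_norm ?(ltW (joint_gt0 _))//.
  by rewrite marginalE// -m0.
have mj : measurable_fun [set: measurableTypeR R]
    (fun u : measurableTypeR R => (phi (x - u) * slab u)%:E).
  by apply/measurable_EFinP; exact: measurable_joint.
move=> /(ae_eq_integral_abs mu measurableT mj) [N [mN N0 sN]].
have NT : N = setT.
  rewrite -subTset => u _; apply: sN => /= /(_ Logic.I) [] /eqP.
  by rewrite gt_eqF.
have := @lebesgue_measure_itv R `]-oo, +oo[; rewrite set_itvNyy /= -NT.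
by move=> muN; move: N0; rewrite [LHS]muN.
Qed.

Lemma slab_weight01 (alpha x : R) : 0 < delta -> 0 <= alpha <= 1 ->
  0 <= slab_weight alpha x <= 1.
Proof.
move=> d0 /andP[a0 a1]; rewrite /slab_weight.
have A : 0 <= alpha * marginal x by rewrite mulr_ge0// ltW// marginal_gt0.
have B : 0 <= (1 - alpha) * phi x by rewrite mulr_ge0 ?subr_ge0// ltW// phi_gt0.
rewrite divr_ge0 ?addr_ge0//=.
have [->|ne] := eqVneq ((1 - alpha) * phi x + alpha * marginal x) 0.
  by rewrite invr0 mulr0.
by rewrite ler_pdivrMr ?mul1r ?lerDr// lt_neqAle eq_sym ne addr_ge0.
Qed.

(* The law (1 - a_alpha(x)) delta_0 + a_alpha(x) gamma_x. The last branch only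
   serves to make it a probability for all values of the parameters. *)
Definition coord_posterior (alpha x : R) (A : set (measurableTypeR R)) :
    \bar R :=
  if (0 < delta) && (0 <= alpha <= 1) then
    ((1 - slab_weight alpha x)%:E * @dirac _ (measurableTypeR R) 0%R R A +
     (slab_weight alpha x)%:E * \int[mu]_(u in A) (slab_post x u)%:E)%E
  else @dirac _ (measurableTypeR R) 0%R R A.

Section coord_posterior_probability.
Context (alpha x : R).

Let measurable_slab_post : measurable_fun setT (slab_post x).
Proof. by apply: measurable_funM => //; exact: measurable_joint. Qed.

Let slab_post_ge0 : 0 < delta -> forall u, 0 <= slab_post x u.
Proof.
move=> d0 u; apply: divr_ge0; last by rewrite ltW// marginal_gt0.
by rewrite mulr_ge0// ltW ?phi_gt0// slab_gt0.
Qed.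

Let integrable_slab_post : 0 < delta ->
  mu.-integrable setT (fun u => (slab_post x u)%:E).
Proof.
move=> d0; under eq_fun do rewrite EFinM.
by apply: integrableZr => //; exact: integrable_joint.
Qed.

Let integral_slab_post : 0 < delta ->
  (\int[mu]_u (slab_post x u)%:E = 1)%E.
Proof.
move=> d0; under eq_integral do rewrite EFinM.
rewrite integralZr//; last exact: integrable_joint.
by rewrite marginalE// -EFinM divff// gt_eqF// marginal_gt0.
Qed.

Let coord_posterior0 : coord_posterior alpha x set0 = 0%E.
Proof.
rewrite /coord_posterior measure0; case: ifP => // _.
by rewrite mule0 integral_set0 mule0 adde0.
Qed.

Let coord_posterior_ge0 A : (0 <= coord_posterior alpha x A)%E.
Proof.
rewrite /coord_posterior; case: ifP => // /andP[d0 a01].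
have /andP[w0 w1] := slab_weight01 x d0 a01.
apply: adde_ge0; apply: mule_ge0 => //; rewrite ?lee_fin ?subr_ge0//.
by apply: integral_ge0 => u _; rewrite lee_fin slab_post_ge0.
Qed.

Let coord_posterior_sigma_additive :
  semi_sigma_additive (coord_posterior alpha x).
Proof.
have [c|/negbTE c] := boolP ((0 < delta) && (0 <= alpha <= 1)); last first.
  rewrite (_ : coord_posterior alpha x = @dirac _ (measurableTypeR R) 0%R R).
    exact: measure_semi_sigma_additive.
  by apply/funext => A; rewrite /coord_posterior c.
move: (c) => /andP[d0 a01].
have /andP[w0 w1] := slab_weight01 x d0 a01.
move=> A mA tA mUA.
have dirac_cvg := @measure_semi_sigma_additive _ _ _
  (@dirac _ (measurableTypeR R) 0%R R) A mA tA mUA.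
have slab_cvg : (fun n => \sum_(0 <= i < n)
      \int[mu]_(u in A i) (slab_post x u)%:E)%E @ \oo -->
    (\int[mu]_(u in \bigcup_i A i) (slab_post x u)%:E)%E.
  rewrite integral_bigcup//=; last first.
    exact: (integrableS _ _ (subsetT _) (integrable_slab_post d0)).
  apply: is_cvg_ereal_nneg_natsum_cond => n _ _.
  by apply: integral_ge0 => u _; rewrite lee_fin slab_post_ge0.
rewrite {2}/coord_posterior c.
rewrite [X in X @ _ --> _](_ : _ = (fun n =>
    (1 - slab_weight alpha x)%:E *
      \sum_(0 <= i < n) @dirac _ (measurableTypeR R) 0%R R (A i) +
    (slab_weight alpha x)%:E *
      \sum_(0 <= i < n) \int[mu]_(u in A i) (slab_post x u)%:E)%E); last first.
  apply/funext => n; under eq_bigr do rewrite /coord_posterior c.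
  rewrite big_split/= ge0_sume_distrr//.
  rewrite ge0_sume_distrr// => i _.
  by apply: integral_ge0 => u _; rewrite lee_fin slab_post_ge0.
apply: cvgeD; [|exact: cvgeZl|exact: cvgeZl].
apply: ge0_adde_def; rewrite inE; apply: mule_ge0;
  rewrite ?lee_fin ?subr_ge0//.
by apply: integral_ge0 => u _; rewrite lee_fin slab_post_ge0.
Qed.

HB.instance Definition _ := isMeasure.Build _ _ _ (coord_posterior alpha x)
  coord_posterior0 coord_posterior_ge0 coord_posterior_sigma_additive.

Let coord_posterior_setT : coord_posterior alpha x setT = 1%E.
Proof.
rewrite /coord_posterior diracT; case: ifP => // /andP[d0 _].
by rewrite integral_slab_post// !mule1 -EFinD subrK.
Qed.

HB.instance Definition _ := Measure_isProbability.Build _ _ _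
  (coord_posterior alpha x) coord_posterior_setT.

End coord_posterior_probability.

Definition posterior n (alpha : R) (x : vec R n) : probability (vec R n) R :=
  @product_prob R n (fun i => coord_posterior alpha (tnth x i)).

(* No convention is hidden in the infimum: for 0 < alpha <= 1 the distribution
   function is strictly increasing, so the median is unique. *)
Definition posterior_median (alpha x : R) : R :=
  inf [set u : R | ((1 / 2)%:E <= coord_posterior alpha x `]-oo, u])%E].

Definition is_threshold (alpha t : R) : Prop :=
  0 < t /\ forall x : R, posterior_median alpha x = 0 <-> `|x| <= t.

Definition log_marginal n (x : vec R n) (alpha : R) : R :=
  \sum_(i < n) ln ((1 - alpha) * phi (tnth x i) + alpha * marginal (tnth x i)).

(* The maximiser is unique outside a finite set of data x, namely those with
   phi (x_i) = marginal (x_i) for all i. *)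
Definition is_mmle n (alpha_n : R) (hat : vec R n -> R) : Prop :=
  measurable_fun setT hat /\
  forall x, alpha_n <= hat x <= 1 /\
    forall alpha, alpha_n <= alpha <= 1 ->
      log_marginal x alpha <= log_marginal x (hat x).

End spike_and_slab.

(* Main.v *)
Require Import Defs.
From HB Require Import structures.
From mathcomp Require Import all_boot all_order all_algebra.
From mathcomp Require Import all_classical all_reals all_analysis.
From mathcomp Require Import measurable_realfun ring lra.

Set Implicit Arguments.
Unset Strict Implicit.
Unset Printing Implicit Defensive.

Import Order.TTheory GRing.Theory Num.Theory.
Import numFieldNormedType.Exports.

Local Open Scope classical_set_scope.
Local Open Scope ring_scope.

(** The posterior risk is a sum over the coordinates. Put [T = ln (n / s)],
    [r = s / n = exp (- T)] and [alpha1 = A r T^(delta / 2)] for a large constant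
    [A], and write [f = (1 - alpha) phi + alpha g] for the marginal density and
    [a = alpha g / f].

    Signals: as [alpha_hat] maximises the likelihood,
    [\sum_i g(X_i) / f(X_i) <= n]. Taking the logarithm of
    [1 - a <= (phi / g) (g / f)] bounds [(1 - a) X_i^2] by a multiple of
    [T + r g(X_i) / f(X_i)], hence the signals cost [O(s T^(q / 2))] for every
    realisation of the noise.

    Null coordinates, [alpha_hat <= alpha1]: the expectation of
    [a(X) (1 + |X|)^q] at level [alpha1] is of order
    [alpha1 T^((q - delta) / 2) = A r T^(q / 2)]. The constant does not depend on
    [delta] because the slab constant [delta / 2] compensates the factor
    [1 / (q - delta)] from the truncated moment, and [delta <= q - delta].

    Null coordinates, [alpha_hat > alpha1]: the score at [alpha1] is nonnegative,
    although [a(X)] has expectation at most [alpha1 - 4 r] under the null. An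
    exponential Markov inequality with parameter [1 / (A T^(delta / 2))] makes this
    event negligible since [s] is at least of order [ln^2 n]. *)

(** * Integration *)

(** The obstacle is the dependence of [alpha_hat] on every observation. The risk of a coordinate is
    therefore bounded, for each realisation, by an expression free of [alpha_hat]: monotonicity of
    the weight in alpha serves below [alpha1], and the indicator of [alpha1 < alpha_hat] is replaced
    by the exponential of the score, a product over coordinates. Even multiplied by [1 + X_i ^ 2] it
    integrates factor by factor.

    The score at [alpha1] is informative only if [alpha1] lies in the interval of maximisation, so
    the definition of [alpha_n] through the median has to be converted into [alpha_n <= alpha1].

    Uniformity in [delta] rests on comparing [g] with the slab up to constants free of [delta]; what
    remains, such as [ln (2 / delta)], moves into conditions that hold for large [n], where
    [T^(delta / 2)] outweighs [1 / delta]. Gaussian moments and tails are not computed: the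
    integrands are dominated by multiples of a normal density of variance 4. *)

Section measure_theory.
Context d (T : measurableType d) (R : realType).
Local Open Scope ereal_scope.

Import HBNNSimple.

(* Unlike [ge0_le_integral], no measurability is needed. *)
Lemma ge0_le_integralT (mu : {measure set T -> \bar R}) (f g : T -> \bar R) :
  (forall x, 0 <= f x) -> (forall x, f x <= g x) ->
  \int[mu]_x f x <= \int[mu]_x g x.
Proof.
move=> f0 fg; have g0 x : 0 <= g x by exact: le_trans (fg x).
rewrite !ge0_integralTE//; apply: ereal_sup_le => _ [h /= hf <-].
exists h => //= x.
exact: le_trans (hf x) (fg x).
Qed.

Section density.
Context (nu m mu : {measure set T -> \bar R}) (rho : T -> R).
Hypothesis mrho : measurable_fun setT rho.
Hypothesis rho0 : forall x, (0 <= rho x)%R.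
Hypothesis nuE : forall A, measurable A ->
  nu A = m A + \int[mu]_(x in A) (rho x)%:E.

Let density_indic (A : set T) : measurable A ->
  \int[nu]_x (\1_A x)%:E =
  \int[m]_x (\1_A x)%:E + \int[mu]_x ((\1_A x)%:E * (rho x)%:E).
Proof.
move=> mA; rewrite !integral_indic// !setIT nuE// [in LHS]integral_mkcond.
congr (_ + _); apply: eq_integral => x _.
by rewrite patchE indicE; case: ifPn => _; rewrite ?mul1e ?mul0e.
Qed.

Let density_nnsfun (h : {nnsfun T >-> R}) :
  \int[nu]_x (h x)%:E =
  \int[m]_x (h x)%:E + \int[mu]_x ((h x)%:E * (rho x)%:E).
Proof.
have mr r : measurable_fun setT (fun x => (\1_(h @^-1` [set r]) x : R)%:E).
  by apply/measurable_EFinP/measurable_indic.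
have dec (nu' : {measure set T -> \bar R}) : \int[nu']_x (h x)%:E =
    \sum_(r \in range h) r%:E * \int[nu']_x (\1_(h @^-1` [set r]) x)%:E.
  under [LHS]eq_integral do rewrite fimfunE -fsumEFin//.
  rewrite [LHS]ge0_integral_fsum//; last 2 first.
    - by move=> r; exact/measurable_EFinP/measurableT_comp.
    - by move=> n x _; rewrite EFinM nnfun_muleindic_ge0.
  by apply: eq_fsbigr => r _; rewrite integralZl_indic_nnsfun.
rewrite !dec.
have -> : \int[mu]_x ((h x)%:E * (rho x)%:E) =
    \sum_(r \in range h) r%:E *
      \int[mu]_x ((\1_(h @^-1` [set r]) x)%:E * (rho x)%:E).
  under [LHS]eq_integral.
    move=> x _; rewrite fimfunE -fsumEFin// muleC ge0_mule_fsumr; last first.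
      by move=> r; rewrite EFinM nnfun_muleindic_ge0.
    over.
  rewrite [LHS]ge0_integral_fsum//; last 2 first.
    - move=> r; apply: emeasurable_funM; first exact/measurable_EFinP.
      by apply/measurable_EFinP/measurable_funM.
    - by move=> n x _; apply: mule_ge0; [rewrite lee_fin|rewrite EFinM nnfun_muleindic_ge0].
  apply: eq_fsbigr => r /[!inE] -[x0 _ <-].
  rewrite -ge0_integralZl//.
  - by apply: eq_integral => x _; rewrite EFinM muleCA [in LHS](muleC (rho x)%:E).
  - by apply: emeasurable_funM => //; exact/measurable_EFinP.
  - by move=> x _; rewrite mule_ge0// lee_fin// indicE.
  - by rewrite lee_fin.
rewrite -fsbig_split//=; apply: eq_fsbigr => r /[!inE] -[x0 _ <-].
rewrite density_indic// ge0_muleDr//; apply: integral_ge0 => x _.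
  by rewrite lee_fin indicE.
by rewrite mule_ge0// lee_fin// indicE.
Qed.

(** One statement serves two laws: the normal law, with [m] zero, and the posterior of a coordinate,
    whose atom at 0 is [m]. The proof goes from indicators to simple functions to monotone
    limits. *)
Lemma integral_density (h : T -> \bar R) :
  measurable_fun setT h -> (forall x, 0 <= h x) ->
  \int[nu]_x h x = \int[m]_x h x + \int[mu]_x (h x * (rho x)%:E).
Proof.
move=> mh h0; pose f_ := nnsfun_approx measurableT mh.
have hE x : h x = limn (fun n => (f_ n x)%:E).
  by apply/esym/cvg_lim => //; exact: cvg_nnsfun_approx.
have ndf x a b : (a <= b)%N -> (f_ a x <= f_ b x)%R.
  by move=> ab; exact/lefP/nd_nnsfun_approx.
have lim_int (nu' : {measure set T -> \bar R}) :
    (fun n => \int[nu']_x (f_ n x)%:E) @ \oo --> \int[nu']_x h x.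
  rewrite (eq_integral (fun x => limn (fun n => (f_ n x)%:E))); last first.
    by move=> x _; exact: hE.
  apply: cvg_monotone_convergence => //.
  - by move=> n; apply/measurable_EFinP.
  - by move=> n x _; rewrite lee_fin.
  - by move=> x _ a b ab; rewrite lee_fin ndf.
have lim_rho : (fun n => \int[mu]_x ((f_ n x)%:E * (rho x)%:E)) @ \oo -->
    \int[mu]_x (h x * (rho x)%:E).
  rewrite (eq_integral (fun x => limn (fun n => (f_ n x)%:E * (rho x)%:E))).
    apply: cvg_monotone_convergence => //.
    - by move=> n; apply/measurable_EFinP/measurable_funM.
    - by move=> n x _; rewrite mule_ge0 ?lee_fin.
    - by move=> x _ a b ab; rewrite lee_wpmul2r ?lee_fin ?ndf.
  move=> x _; apply/esym/cvg_lim => //; apply: cvgeZr => //.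
  exact: cvg_nnsfun_approx.
have := lim_int nu.
have -> : (fun n => \int[nu]_x (f_ n x)%:E) = (fun n => \int[m]_x (f_ n x)%:E +
    \int[mu]_x ((f_ n x)%:E * (rho x)%:E)).
  by apply/funext => n; exact: density_nnsfun.
move=> lim_nu.
have lim_sum : (fun n => \int[m]_x (f_ n x)%:E +
    \int[mu]_x ((f_ n x)%:E * (rho x)%:E)) @ \oo -->
    \int[m]_x h x + \int[mu]_x (h x * (rho x)%:E).
  apply: cvgeD; [|exact: lim_int|exact: lim_rho].
  apply: ge0_adde_def; rewrite inE; first exact: integral_ge0.
  by apply: integral_ge0 => x _; rewrite mule_ge0 ?lee_fin.
exact: (cvg_unique _ lim_nu lim_sum).
Qed.

End density.

End measure_theory.

(** * Expectations under product laws *)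

Section product_integral.
Context {R : realType}.
Local Open Scope ereal_scope.
Local Notation RR := (measurableTypeR R).

Lemma measurable_shift (c : R) :
  measurable_fun [set: RR] (fun e : RR => (c + (e : R))%R : RR).
Proof. by apply: measurable_funD => //. Qed.

Lemma measurable_prod_tnth n (h : 'I_n -> RR -> R) :
  (forall j, measurable_fun setT (h j)) ->
  measurable_fun setT (fun x : vec R n => (\prod_(j < n) h j (tnth x j))%R).
Proof.
move=> mh; apply: (@measurable_prod _ _ _ _ _ _ (fun j (x : vec R n) => h j (tnth x j))) => j _.
by apply: measurableT_comp => //; exact: measurable_tnth.
Qed.

(** Independence in the form used throughout: induction on [n], with Tonelli splitting off the first
    coordinate. Functions of a single coordinate are the case where all other factors are 1. *)
Lemma integral_product_prob n (P : 'I_n -> probability RR R)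
    (h : 'I_n -> RR -> R) :
  (forall j, measurable_fun setT (h j)) -> (forall j x, (0 <= h j x)%R) ->
  \int[product_prob P]_x (\prod_(j < n) h j (tnth x j))%R%:E =
  \prod_(j < n) \int[P j]_x (h j x)%:E.
Proof.
elim: n P h => [|n IH] P h mh h0.
  rewrite big_ord0 /=; under eq_integral do rewrite big_ord0.
  by rewrite integral_cst// mul1e; exact: diracT.
rewrite big_ord_recl /= ge0_integral_pushforward//; last 2 first.
- apply/measurable_EFinP; exact: measurable_prod_tnth.
- by move=> x _; rewrite lee_fin; apply: prodr_ge0.
rewrite preimage_setT.
pose H (z : RR * vec R n) : \bar R :=
  ((h ord0 z.1 * \prod_(j < n) h (lift ord0 j) (tnth z.2 j))%R)%:E.
have mp := @measurable_prod_tnth n (fun j => h (lift ord0 j)) (fun j => mh _).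
have mH : measurable_fun setT H.
  apply/measurable_EFinP/measurable_funM.
    by apply: measurableT_comp => //; exact: measurable_fst.
  exact: measurableT_comp mp measurable_snd.
rewrite (eq_integral H); last first.
  move=> z _; rewrite /H /= big_ord_recl; congr (_ * _)%R%:E.
  by apply: eq_bigr => j _; rewrite tnthS.
rewrite fubini_tonelli1//; last first.
  by move=> z; rewrite lee_fin mulr_ge0// prodr_ge0.
rewrite /fubini_F /H /=.
rewrite -(IH (fun j => P (lift ord0 j)) (fun j => h (lift ord0 j)))//.
rewrite -ge0_integralZr//; last 3 first.
- exact/measurable_EFinP.
- by move=> x _; rewrite lee_fin.
- by apply: integral_ge0 => x _; rewrite lee_fin prodr_ge0.
apply: eq_integral => x _; rewrite -ge0_integralZl_EFin//.
- by move=> y _; rewrite lee_fin prodr_ge0.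
- exact/measurable_EFinP.
Qed.

Lemma integral_law_of_X n (theta : vec R n) (h : 'I_n -> RR -> R) :
  (forall j, measurable_fun setT (h j)) -> (forall j x, (0 <= h j x)%R) ->
  \int[law_of_X theta]_x (\prod_(j < n) h j (tnth x j))%R%:E =
  \prod_(j < n)
    \int[normal_prob 0 1]_e (h j ((tnth theta j : R) + (e : R))%R)%:E.
Proof.
move=> mh h0; rewrite /law_of_X ge0_integral_pushforward//; last 2 first.
- apply/measurable_EFinP; exact: measurable_prod_tnth.
- by move=> x _; rewrite lee_fin; apply: prodr_ge0.
rewrite preimage_setT -integral_product_prob//; last first.
  by move=> j; exact: measurableT_comp (mh j) (measurable_shift _).
by apply: eq_integral => x _ /=; under eq_bigr do rewrite tnth_mktuple.
Qed.

Lemma integral_product_prob1 n (P : 'I_n -> probability RR R) (i : 'I_n)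
    (h : RR -> R) : measurable_fun setT h -> (forall x, (0 <= h x)%R) ->
  \int[product_prob P]_x (h (tnth x i))%:E = \int[P i]_x (h x)%:E.
Proof.
move=> mh h0; pose k j : RR -> R := if j == i then h else cst 1%R.
rewrite (eq_integral (fun x => (\prod_(j < n) k j (tnth x j))%R%:E)); last first.
  move=> x _; rewrite (bigD1 i)//= /k eqxx big1 ?mulr1// => j /negbTE ->.
  by [].
rewrite integral_product_prob.
- rewrite (bigD1 i)//= /k eqxx big1 ?mule1// => j /negbTE ->.
  by rewrite (@integral_cst _ _ _ (P j) setT measurableT 1%E) mul1e; exact: probability_setT.
- by move=> j; rewrite /k; case: ifP.
- by move=> j x; rewrite /k; case: ifP.
Qed.

Lemma integral_law_of_X1 n (theta : vec R n) (i : 'I_n) (h : RR -> R) :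
  measurable_fun setT h -> (forall x, (0 <= h x)%R) ->
  \int[law_of_X theta]_x (h (tnth x i))%:E =
  \int[normal_prob 0 1]_e (h ((tnth theta i : R) + (e : R))%R)%:E.
Proof.
move=> mh h0; rewrite /law_of_X ge0_integral_pushforward//; last 2 first.
- by apply/measurable_EFinP; apply: (measurableT_comp mh); exact: measurable_tnth.
- by move=> x _; rewrite lee_fin.
rewrite preimage_setT -(@integral_product_prob1 n (fun=> normal_prob 0 1) i)//.
- by apply: eq_integral => x _ /=; rewrite tnth_mktuple.
- exact: measurableT_comp mh (measurable_shift _).
Qed.

End product_integral.

Section densities.
Context {R : realType}.
Local Notation RR := (measurableTypeR R).
Local Notation mu := (@lebesgue_measure R).
Local Open Scope ereal_scope.

Lemma integral_normal_prob (m sigma : R) (h : RR -> \bar R) : sigma != 0%R ->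
  measurable_fun setT h -> (forall x, 0 <= h x) ->
  \int[normal_prob m sigma]_x h x =
  \int[mu]_x (h x * (normal_pdf m sigma x)%:E).
Proof.
move=> s0 mh h0.
rewrite (@integral_density _ _ _ _ mzero mu (normal_pdf m sigma))//.
- by rewrite integral_measure_zero add0e.
- exact: measurable_normal_pdf.
- by move=> x; exact: normal_pdf_ge0.
- by move=> A mA; rewrite /mzero add0e.
Qed.

Section coordinate.
Context (delta alpha x : R).
Hypothesis delta0 : (0 < delta)%R.
Hypothesis alpha01 : (0 <= alpha <= 1)%R.

Lemma measurable_slab_post : measurable_fun [set: RR] (slab_post delta x : RR -> R).
Proof. by apply: measurable_funM => //; exact: measurable_joint. Qed.

Lemma slab_post_ge0 u : (0 <= slab_post delta x u)%R.
Proof.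
apply: divr_ge0; last by rewrite ltW// marginal_gt0.
by apply: mulr_ge0; rewrite ltW// ?phi_gt0// slab_gt0.
Qed.

Lemma integral_coord_posterior (h : RR -> \bar R) :
  measurable_fun setT h -> (forall u, 0 <= h u) ->
  \int[coord_posterior delta alpha x]_u h u =
  (1 - slab_weight delta alpha x)%:E * h 0%R +
  (slab_weight delta alpha x)%:E * \int[mu]_u (h u * (slab_post delta x u)%:E).
Proof.
move=> mh h0.
have /andP[w0 w1] := slab_weight01 x delta0 alpha01.
have w1' : (0 <= 1 - slab_weight delta alpha x)%R by rewrite subr_ge0.
set a := slab_weight delta alpha x in w0 w1 w1' *.
rewrite (@integral_density _ _ _ _ (mscale (NngNum w1') (@dirac _ RR 0%R R)) mu
   (fun u => (a * slab_post delta x u)%R))//.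
- rewrite ge0_integral_mscale// integral_dirac// diracT mul1e; congr (_ + _).
  rewrite -ge0_integralZl//; last 2 first.
  + apply: emeasurable_funM => //; apply/measurable_EFinP.
    exact: measurable_slab_post.
  + by move=> u _; rewrite mule_ge0// lee_fin slab_post_ge0.
  by apply: eq_integral => u _; rewrite EFinM muleCA.
- by apply: measurable_funM => //; exact: measurable_slab_post.
- by move=> u; rewrite mulr_ge0// slab_post_ge0.
- move=> A mA; change (coord_posterior delta alpha x A = (1 - a)%:E *
    @dirac _ RR 0%R R A + \int[mu]_(u in A) (a * slab_post delta x u)%:E).
  rewrite /coord_posterior delta0 alpha01 /= -/a.
  congr (_ + _).
  rewrite -ge0_integralZl//.
  + apply/measurable_EFinP; apply: measurable_funTS.
    exact: measurable_slab_post.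
  + by move=> u _; rewrite lee_fin slab_post_ge0.
Qed.

End coordinate.

Lemma measurable_dist_powR (q c : R) :
  measurable_fun [set: RR] (fun u : RR => (`|(u : R) - c| `^ q)%R).
Proof.
have m1 : measurable_fun [set: RR] (fun u : RR => `|(u : R) - c|%R : RR).
  by apply: measurableT_comp => //; exact: measurable_funB.
exact: measurableT_comp (measurable_powR q) m1.
Qed.

Lemma integral_posterior_dq n (delta alpha q : R) (x theta0 : vec R n) :
  \int[posterior delta alpha x]_theta (dq q theta theta0)%:E =
  \sum_(i < n) \int[coord_posterior delta alpha (tnth x i)]_u
     (`|(u : R) - (tnth theta0 i : R)| `^ q)%R%:E.
Proof.
rewrite (eq_integral (fun theta : vec R n =>
  \sum_(i < n) (`|(tnth theta i : R) - (tnth theta0 i : R)| `^ q)%R%:E)); last first.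
  by move=> theta _; rewrite /dq sumEFin.
rewrite ge0_integral_sum//; last first.
  move=> i; apply/measurable_EFinP.
  exact: measurableT_comp (measurable_dist_powR _ _) (measurable_tnth _).
apply: eq_bigr => i _.
exact: (@integral_product_prob1 R n (fun i => coord_posterior delta alpha (tnth x i))
    i _ (measurable_dist_powR q (tnth theta0 i)) (fun=> powR_ge0 _ _)).
Qed.

End densities.

(** * Bounds on the Gaussian and slab densities *)

Section gaussian_slab_bounds.
Context {R : realType}.
Local Notation RR := (measurableTypeR R).
Local Notation mu := (@lebesgue_measure R).

Lemma phiE (t : R) : phi t = normal_peak 1 * expR (- (t ^+ 2 / 2)).
Proof.
rewrite /phi normal_pdfE ?oner_neq0// /normal_fun subr0 expr1n.
by rewrite mulNr.
Qed.

Lemma normal_peak1_le1 : normal_peak 1 <= 1 :> R.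
Proof.
rewrite /normal_peak invf_le1; last first.
  by rewrite sqrtr_gt0 expr1n mul1r mulrn_wgt0// pi_gt0.
rewrite -[leLHS]sqrtr1 ler_wsqrtr// expr1n mul1r mulr2n.
by have := pi_ge2 R; lra.
Qed.

Lemma normal_peak12 : normal_peak 1 = 2 * normal_peak 2 :> R.
Proof.
rewrite /normal_peak -!(mulrnAr _ pi) expr1n mul1r sqrtrM ?sqr_ge0//.
by rewrite sqrtr_sqr ger0_norm// invfM mulrA divff ?mul1r.
Qed.

(** Passing from variance 1 to variance 4 frees the exponent [1/2 - 1/8 = 3/8]. It is spent on
    polynomial factors and on tail decay in the next two bounds. *)
Lemma phi_pdf2 (t : R) :
  phi t * expR (3 * t ^+ 2 / 8) = 2 * normal_pdf 0 2 t.
Proof.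
rewrite phiE normal_pdfE// /normal_fun subr0 normal_peak12 -!mulrA.
congr (_ * (_ * _)); rewrite -expRD; congr expR.
by field.
Qed.

Lemma phi_le1 (t : R) : phi t <= 1.
Proof.
exact: le_trans (normal_pdf_ub _ _ (oner_neq0 _)) normal_peak1_le1.
Qed.

Lemma phi_poly4_le (t : R) :
  phi t * (1 + t ^+ 2) ^+ 2 <= 58 * normal_pdf 0 2 t.
Proof.
have := phi_pdf2 t; have p0 := phi_gt0 t.
have e1 : 1 + 3 * t ^+ 2 / 16 <= expR (3 * t ^+ 2 / 16) by exact: expR_ge1Dx.
have -> : expR (3 * t ^+ 2 / 8) = expR (3 * t ^+ 2 / 16) ^+ 2.
  by rewrite -expRM_natl; congr expR; lra.
set e := expR _ in e1 *; set p := phi t in p0 *; set r := normal_pdf _ _ _.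
move=> pe; have t0 := sqr_ge0 t; set y := t ^+ 2 in e1 t0 *.
(* From [e1], [1 + y <= (16 / 3) * e], and the square of [16 / 3] is below 29. *)
have : (1 + y) ^+ 2 <= 29 * e ^+ 2 by nra.
by nra.
Qed.

Lemma phi_tail_le (t z : R) : 8 * z <= t ^+ 2 ->
  phi t * (1 + t ^+ 2) <= 8 * expR (- z) * normal_pdf 0 2 t.
Proof.
move=> tz; have p0 := phi_gt0 t.
have e1 : 1 + t ^+ 2 / 4 <= expR (t ^+ 2 / 4) by exact: expR_ge1Dx.
have e2 : 1 <= expR (- z) * expR (t ^+ 2 / 8).
  by rewrite -expRD -[leLHS]expR0 ler_expR; lra.
(* The part [1/4] of the exponent pays for the polynomial, the part [1/8] for [expR (- z)]. *)
have E : expR (3 * t ^+ 2 / 8) = expR (t ^+ 2 / 4) * expR (t ^+ 2 / 8).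
  by rewrite -expRD; congr expR; lra.
have := phi_pdf2 t; rewrite E => pdfE.
have -> : 8 * expR (- z) * normal_pdf 0 2 t =
    phi t * (4 * (expR (t ^+ 2 / 4) * (expR (- z) * expR (t ^+ 2 / 8)))).
  rewrite (_ : 8 * expR (- z) * normal_pdf 0 2 t =
    4 * expR (- z) * (2 * normal_pdf 0 2 t)); last by ring.
  by rewrite -pdfE; ring.
rewrite ler_pM2l//.
have := ler_peMr (expR_ge0 (t ^+ 2 / 4)) e2.
by lra.
Qed.

Section slab.
Context (delta : R).
Hypothesis delta01 : 0 < delta <= 1.

Let d0 : 0 < delta. Proof. by case/andP: delta01. Qed.

Lemma slab_ge0 (x : R) : 0 <= slab delta x.
Proof. by rewrite ltW// slab_gt0. Qed.

Lemma phi_ge0 (x : R) : 0 <= phi x.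
Proof. by rewrite ltW// phi_gt0. Qed.

Lemma joint_ge0 (x u : R) : 0 <= phi (x - u) * slab delta u.
Proof. by rewrite mulr_ge0 ?phi_ge0 ?slab_ge0. Qed.

Lemma joint_moment_ge0 (x u : R) :
  0 <= phi (x - u) * slab delta u * (1 + (u - x) ^+ 2).
Proof. by rewrite mulr_ge0 ?joint_ge0 ?addr_ge0 ?sqr_ge0. Qed.

(** A polynomial tail changes by at most [r^(1 + delta)] when [1 + |u|] grows by a factor [r]. As
    [delta <= 1], the exponent 2 is uniform in [delta]. *)
Lemma slab_le_ratio (x u r : R) : 1 <= r -> 1 + `|u| <= r * (1 + `|x|) ->
  slab delta x <= r ^+ 2 * slab delta u.
Proof.
move=> r1 ur; rewrite /slab mulrCA ler_pM2l ?slab_const_gt0// /slab_shape.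
have X0 := slab_shape_arg_gt0 x; have U0 := slab_shape_arg_gt0 u.
have r0 : 0 < r by lra.
have mN (y : R) : 0 < y -> y `^ (- 1 - delta) = (y `^ (1 + delta))^-1.
  by move=> y0; rewrite -powRN; congr (_ `^ _); lra.
rewrite !mN// -[leLHS]div1r ler_pdivrMr ?powR_gt0// -mulrA [X in _ <= _ * X]mulrC.
rewrite mulrA ler_pdivlMr ?powR_gt0// mul1r.
apply: (@le_trans _ _ ((r * (1 + `|x|)) `^ (1 + delta))).
  apply: ge0_ler_powR => //; rewrite ?nnegrE; [|exact: ltW|].
  - by have := d0; lra.
  - by rewrite mulr_ge0// ltW.
rewrite powRM// ?(ltW r0)// ?(ltW X0)//.
rewrite ler_pM2r ?powR_gt0// -powR_mulrn ?(ltW r0)//.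
by apply: ler_powR => //; have := delta01; lra.
Qed.

(** Moving the slab from [u] to [x] costs [(1 + |x - u|)^2], which the Gaussian factor absorbs
    together with the second moment: a polynomial of degree 4 in all, and [116 = 2 * 58]. Integrated
    over [u], this compares [g] with the slab from above. *)
Lemma joint_moment_le (x u : R) :
  phi (x - u) * slab delta u * (1 + (u - x) ^+ 2) <=
  116 * slab delta x * normal_pdf x 2 u.
Proof.
set t := x - u; have -> : u - x = - t by rewrite /t opprB.
have -> : normal_pdf x 2 u = normal_pdf 0 2 t.
  rewrite !normal_pdfE// /normal_fun subr0.
  by congr (_ * expR _); rewrite /t -sqrrN opprB.
rewrite sqrrN.
have h : slab delta u <= (1 + `|t|) ^+ 2 * slab delta x.
  apply: slab_le_ratio; first by rewrite lerDl.
  have : `|x| <= `|t| + `|u| by rewrite (_ : x = t + u) ?ler_normD// /t subrK.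
  have := mulr_ge0 (normr_ge0 t) (normr_ge0 u).
  by set a := `|t|; set b := `|u|; set c := `|x| => ab cab; lra.
have h2 : (1 + `|t|) ^+ 2 <= 2 * (1 + t ^+ 2).
  by rewrite -[t ^+ 2]real_normK ?num_real//; have := sqr_ge0 (1 - `|t|); nra.
have := phi_poly4_le t; have := phi_gt0 t; have := slab_gt0 d0 x.
have := slab_gt0 d0 u; have := sqr_ge0 t; move: h h2.
set p := phi t; set su := slab _ u; set sx := slab _ x; set y := t ^+ 2.
set N := normal_pdf _ _ _; set w := (_ + _) ^+ 2 => h h2 y0 su0 sx0 p0 pN.
have su2 : su <= 2 * (1 + y) * sx by rewrite (le_trans h)// ler_pM2r.
apply: (@le_trans _ _ (p * (2 * (1 + y) * sx) * (1 + y))).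
  by rewrite ler_wpM2r ?ler_pM2l//; lra.
by nra.
Qed.

Lemma integral_joint_moment_le (x : R) :
  (\int[mu]_u (phi (x - u) * slab delta u * (1 + (u - x) ^+ 2))%:E <=
   (116 * slab delta x)%:E)%E.
Proof.
have sx := slab_gt0 d0 x.
apply: (@le_trans _ _
  (\int[mu]_u ((116 * slab delta x)%:E * (normal_pdf x 2 u)%:E))%E).
  apply: ge0_le_integralT => u; first by
    rewrite lee_fin joint_moment_ge0.
  by rewrite -EFinM lee_fin joint_moment_le.
rewrite ge0_integralZl//.
- by rewrite integral_normal_pdf// mule1.
- by apply/measurable_EFinP; exact: measurable_normal_pdf.
- by move=> u _; rewrite lee_fin normal_pdf_ge0.
- by rewrite lee_fin; lra.
Qed.

Lemma marginal_le_slab (x : R) : marginal delta x <= 116 * slab delta x.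
Proof.
rewrite -lee_fin -marginalE//; apply: le_trans (integral_joint_moment_le x).
apply: ge0_le_integralT => u.
  by rewrite lee_fin joint_ge0.
rewrite lee_fin ler_peMr ?lerDl ?sqr_ge0//.
by rewrite joint_ge0.
Qed.

(** Keeping only [u] in [[x, x + 1]] loses a factor [phi 1] from the Gaussian and at most [2^2] from
    the slab. *)
Lemma slab_le_marginal (x : R) : phi 1 / 4 * slab delta x <= marginal delta x.
Proof.
have sx := slab_gt0 d0 x; have p1 := @phi_gt0 R 1.
rewrite -lee_fin -marginalE//.
apply: (@le_trans _ _ (\int[mu]_(u in `[x, (x + 1)%R]) (phi 1 / 4 * slab delta x)%:E)%E).
  rewrite integral_cst//= lebesgue_measure_itv/= lte_fin ltrDl ltr01.
  by rewrite -EFinD addrAC subrr add0r mule1.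
have j0 u : (0 <= (phi (x - u) * slab delta u)%:E)%E.
  by rewrite lee_fin joint_ge0.
have mj : measurable_fun [set: RR] (fun u : RR => (phi (x - u) * slab delta u)%:E).
  by apply/measurable_EFinP; exact: measurable_joint.
apply: (@le_trans _ _ (\int[mu]_(u in `[x, (x + 1)%R]) (phi (x - u) * slab delta u)%:E)%E).
  apply: ge0_le_integral => //.
  - by move=> u _; rewrite lee_fin mulr_ge0 ?slab_ge0// divr_ge0 ?phi_ge0.
  - exact: measurable_funTS.
  move=> u /=; rewrite in_itv /= => /andP[xu ux]; rewrite lee_fin.
  have h : slab delta x <= 2 ^+ 2 * slab delta u.
    apply: slab_le_ratio; first by lra.
    have : `|u| <= `|x| + `|u - x| by rewrite -{1}(subrK x u) addrC ler_normD.
    by rewrite [`|u - x|]ger0_norm ?subr_ge0//; have := normr_ge0 x; lra.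
  have hp : phi 1 <= phi (x - u).
    rewrite !phiE ler_pM2l ?normal_peak_gt0 ?oner_neq0// ler_expR lerN2.
    by nra.
  rewrite -mulrA ler_pM// ?(ltW p1)//; last by move: h; lra.
  by rewrite mulr_ge0// ltW.
exact: ge0_subset_integral.
Qed.

End slab.
End gaussian_slab_bounds.

(** * The marginal density and the posterior weights *)

Section marginal.
Context {R : realType}.
Local Notation RR := (measurableTypeR R).
Local Notation mu := (@lebesgue_measure R).
Context (delta : R).
Hypothesis delta0 : 0 < delta.

Let joint2 (z : RR * RR) : \bar R := (phi ((z.1 : R) - z.2) * slab delta z.2)%:E.

Let measurable_joint2 : measurable_fun setT joint2.
Proof.
have m1 : measurable_fun setT (fun z : RR * RR => (z.1 : R) - z.2 : RR).
  by apply: measurable_funB; [exact: measurable_fst|exact: measurable_snd].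
apply/measurable_EFinP/measurable_funM.
  exact: measurableT_comp (measurable_normal_pdf _ _) m1.
exact: measurableT_comp (measurable_slab delta) measurable_snd.
Qed.

Let joint2_ge0 z : (0 <= joint2 z)%E.
Proof. by rewrite lee_fin mulr_ge0// ltW ?phi_gt0// slab_gt0. Qed.

Lemma measurable_phi : measurable_fun [set: RR] (phi : RR -> R).
Proof. exact: measurable_normal_pdf. Qed.

Lemma measurable_marginal : measurable_fun [set: RR] (marginal delta : RR -> R).
Proof.
apply/measurable_EFinP.
rewrite (_ : _ \o _ = fubini_F mu joint2).
  exact: measurable_fun_fubini_tonelli_F.
by apply/funext => x; rewrite /fubini_F /= -marginalE.
Qed.

Lemma slab_constE : slab_const delta = delta / 2.
Proof. by rewrite /slab_const /Rintegral integral_slab_shape//= invfM invrK mulrC. Qed.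

Lemma integral_slab : (\int[mu]_x (slab delta x)%:E = 1)%E.
Proof.
under eq_integral do rewrite EFinM.
rewrite ge0_integralZl//.
- rewrite integral_slab_shape// slab_constE -EFinM mulf_div [delta * 2]mulrC divff//.
  by rewrite mulf_neq0// gt_eqF.
- by apply/measurable_EFinP; exact: measurable_slab_shape.
- by move=> x _; rewrite lee_fin powR_ge0.
- by rewrite lee_fin ltW// slab_const_gt0.
Qed.

Lemma integral_marginal : (\int[mu]_x (marginal delta x)%:E = 1)%E.
Proof.
rewrite (eq_integral (fubini_F mu joint2)); last first.
  by move=> x _; rewrite /fubini_F /= -marginalE.
rewrite /fubini_F fubini_tonelli// -integral_slab.
apply: eq_integral => u _; rewrite /joint2 /=.
under eq_integral do rewrite EFinM.
rewrite ge0_integralZr//.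
- rewrite (eq_integral (fun x : RR => (normal_pdf u 1 x)%:E)).
    by rewrite integral_normal_pdf ?oner_neq0// mul1e.
  move=> x _; congr EFin.
  by rewrite /phi !normal_pdfE ?oner_neq0// /normal_fun subr0.
- apply/measurable_EFinP; apply: measurableT_comp measurable_phi _.
  by apply: measurable_funB.
- by move=> x _; rewrite lee_fin ltW// phi_gt0.
- by rewrite lee_fin ltW// slab_gt0.
Qed.

Section weight.
Context (alpha : R).
Hypothesis alpha01 : 0 <= alpha <= 1.

Definition mixture (x : R) := (1 - alpha) * phi x + alpha * marginal delta x.

Lemma mixture_gt0 (x : R) : 0 < mixture x.
Proof.
have /andP[a0 a1] := alpha01; have := phi_gt0 x; have := marginal_gt0 x delta0.
rewrite /mixture; move: (phi x) (marginal _ x) => p g g0 p0.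
have [->|an0] := eqVneq alpha 0; first by rewrite subr0 mul1r mul0r addr0.
by rewrite ltr_wpDl ?mulr_ge0 ?subr_ge0 ?(ltW p0)// mulr_gt0// lt_def an0.
Qed.

Lemma slab_weightE (x : R) :
  slab_weight delta alpha x = alpha * marginal delta x / mixture x.
Proof. by []. Qed.

Lemma measurable_slab_weight :
  measurable_fun [set: RR] (slab_weight delta alpha : RR -> R).
Proof.
have -> : slab_weight delta alpha =
    (fun x => alpha * marginal delta x * mixture x `^ (-1)).
  by apply/funext => x; rewrite powR_inv1 ?slab_weightE// ltW// mixture_gt0.
apply: measurable_funM; first by apply: measurable_funM => //; exact: measurable_marginal.
have mm : measurable_fun [set: RR] (mixture : RR -> RR).
  apply: measurable_funD; apply: measurable_funM => //.
  - exact: measurable_phi.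
  - exact: measurable_marginal.
exact: measurableT_comp (measurable_powR (-1)) mm.
Qed.

Lemma onem_slab_weight (x : R) :
  1 - slab_weight delta alpha x = (1 - alpha) * phi x / mixture x.
Proof.
have f0 := mixture_gt0 x; rewrite slab_weightE.
by rewrite -[X in X - _](divff (lt0r_neq0 f0)) -mulrBl /mixture addrK.
Qed.

(** Both sides equal the product of the two mixture components divided by the mixture. Integrated,
    this says that the expected posterior weight under the mixture is the prior weight, which is how
    [null_weight_le] obtains a bound with leading constant exactly 1. *)
Lemma slab_weight_detailed_balance (x : R) :
  (1 - alpha) * (phi x * slab_weight delta alpha x) =
  alpha * (marginal delta x * (1 - slab_weight delta alpha x)).
Proof. by rewrite onem_slab_weight slab_weightE; ring. Qed.

Lemma slab_weight_ge (x c : R) : 0 < c < 1 ->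
  c * ((1 - alpha) * phi x) <= (1 - c) * (alpha * marginal delta x) ->
  c <= slab_weight delta alpha x.
Proof.
move=> c01 h; rewrite slab_weightE ler_pdivlMr ?mixture_gt0// /mixture.
by move: h; lra.
Qed.

End weight.

Lemma phi_slab_weight_le (alpha x : R) : 0 <= alpha <= 1 / 2 ->
  phi x * slab_weight delta alpha x <= 2 * alpha * marginal delta x.
Proof.
move=> a2; have a01 : 0 <= alpha <= 1 by lra.
have /andP[w0 w1] := slab_weight01 x delta0 a01.
have := slab_weight_detailed_balance a01 x; have g0 := marginal_gt0 x delta0.
have p0 := phi_gt0 x.
move: (slab_weight _ _ _) w0 w1 (phi x) p0 (marginal _ x) g0 => w w0 w1 p p0 g g0 e.
have h : (1 - alpha) * (p * w) <= alpha * g.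
  by rewrite e ler_wpM2l//; [lra|rewrite ler_piMr; lra].
have : 0 <= p * w by rewrite mulr_ge0// ltW.
nra.
Qed.

End marginal.

(** * Slab integrals and null moments of the weight *)

Section slab_integrals.
Context {R : realType}.
Local Notation RR := (measurableTypeR R).
Local Notation mu := (@lebesgue_measure R).

(** Both signs of [d] occur: [d = delta] for the tail of the slab, and [d = delta - q], which is
    negative, for its truncated moment of order [q]. *)
Lemma integral_slab_shape_itv (d a b : R) : d != 0 -> 0 <= a -> a < b ->
  (\int[mu]_(x in `[a, b]) (slab_shape d x)%:E =
   (((1 + a) `^ (- d) - (1 + b) `^ (- d)) / d)%:E)%E.
Proof.
move=> d0 a0 ab; pose F (x : R) : R := - d^-1 * (1 + x) `^ (- d).
have dF (x : R) : 0 <= x -> is_derive x 1 F ((1 + x) `^ (- 1 - d)).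
  move=> x0; have x1 : 0 < 1 + x by rewrite ltr_pwDl.
  have H : is_derive x 1 (fun x : R => 1 + x) 1.
    rewrite -[X in is_derive _ _ _ X]add0r.
    exact: (is_deriveD (is_derive_cst _ _ _) (is_derive_id _ _)).
  have -> : (1 + x) `^ (- 1 - d) =
      - d^-1 *: ((- d * (1 + x) `^ (- d - 1)) * 1).
    rewrite /GRing.scale/= mulr1 mulrA mulrNN mulVf// mul1r.
    by rewrite [- 1 - d]addrC.
  exact: (is_deriveZ (- d^-1)
    (is_derive1_comp (is_derive1_powR (- d) x1) H)).
have cF (x : R) : 0 <= x -> F y @[y --> x] --> F x.
  move=> x0; apply: differentiable_continuous.
  by apply/derivable1_diffP; have [] := dF _ x0.
rewrite (@continuous_FTC2 _ _ F)//.
- by rewrite -EFinB; congr EFin; rewrite /F; ring.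
- exact/continuous_subspaceT/continuous_slab_shape.
- split.
  + by move=> x; rewrite in_itv/= => /andP[ax _]; have [] := dF x (le_trans a0 (ltW ax)).
  + exact/cvg_at_right_filter/cF.
  + exact/cvg_at_left_filter/cF/(le_trans a0 (ltW ab)).
- move=> x; rewrite in_itv/= => /andP[/ltW ax _].
  have x0 := le_trans a0 ax.
  have := dF _ x0 => -[_]; rewrite derive1E => ->.
  by rewrite /slab_shape ger0_norm.
Qed.

Lemma integral_slab_shape_opp (d z : R) : 0 <= z ->
  (\int[mu]_(x in `[(- z)%R, 0%R]) (slab_shape d x)%:E =
   \int[mu]_(x in `[0%R, z]) (slab_shape d x)%:E)%E.
Proof.
move=> z0; have := @integration_by_substitution_oppr R (slab_shape d) 0 z z0.
rewrite oppr0 => ->; last exact/continuous_subspaceT/continuous_slab_shape.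
by apply: eq_integral => x _; rewrite /= /slab_shape normrN.
Qed.

Lemma integral_mul_indic (A : set RR) (k : RR -> R) : measurable A ->
  (\int[mu]_x (k x * \1_A x)%:E = \int[mu]_(x in A) (k x)%:E)%E.
Proof.
move=> mA; rewrite [RHS]integral_mkcond; apply: eq_integral => x _.
by rewrite patchE indicE; case: ifPn => _; rewrite ?mulr1 ?mulr0.
Qed.

Section moments.
Context (delta : R).
Hypothesis delta01 : 0 < delta <= 1.

Let d0 : 0 < delta. Proof. by case/andP: delta01. Qed.

Lemma slab_mul_powR (q x : R) :
  slab delta x * (1 + `|x|) `^ q = delta / 2 * slab_shape (delta - q) x.
Proof.
rewrite /slab slab_constE// /slab_shape -mulrA; congr (_ * _).
have x0 := slab_shape_arg_gt0 x.
have -> : - 1 - (delta - q) = - 1 - delta + q by ring.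
by rewrite [RHS]powRD// (gt_eqF x0) implybT.
Qed.

Lemma integral_slab_mul_powR_le (q z : R) : 2 * delta < q -> 0 < z ->
  (\int[mu]_(x in `[0%R, z]) (delta / 2 * slab_shape (delta - q) x)%:E <=
   ((1 + z) `^ (q - delta) / 2)%:E)%E.
Proof.
move=> dq z0; have dq' : delta - q < 0 by move: d0; lra.
under eq_integral do rewrite EFinM.
rewrite ge0_integralZl//; last 3 first.
- apply/measurable_EFinP; apply: measurable_funTS.
  exact: (measurable_slab_shape (delta - q)).
- by move=> x _; rewrite lee_fin powR_ge0.
- by rewrite lee_fin; move: d0; lra.
rewrite integral_slab_shape_itv// ?lt_eqF// -EFinM lee_fin addr0 powR1 opprB.
have P0 : 0 <= (1 + z) `^ (q - delta) by exact: powR_ge0.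
set P := _ `^ _ in P0 *.
rewrite -[delta - q]opprB invrN mulrN -mulNr opprB mulrCA mulrA.
rewrite ler_pdivrMr; last by lra.
have h : delta <= q - delta by lra.
move: d0 P0 h; set e := q - delta => d0' P0 h.
nra.
Qed.

Lemma slab_tail_ge (z : R) : 0 <= z -> exists2 w, z < w &
  (((1 + z) `^ (- delta) / 4)%:E <= \int[mu]_(x in `[z, w]) (slab delta x)%:E)%E.
Proof.
move=> z0; have z1 : 0 < 1 + z by rewrite ltr_pwDl.
(* The point [w] solves [(1 + w)^delta = 2 (1 + z)^delta]. The one-sided tail beyond [z] has mass
   [(1 + z)^(- delta) / 2], and half of it lies in [[z, w]]. *)
have zw : z < (1 + z) * 2 `^ delta^-1 - 1.
  have h : (1 : R) `^ delta^-1 < 2 `^ delta^-1.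
    by apply: gt0_ltr_powR; rewrite ?invr_gt0 ?nnegrE ?ltr1n.
  by rewrite ltrBrDl ltr_pMr//; rewrite powR1 in h.
exists ((1 + z) * 2 `^ delta^-1 - 1) => //.
under eq_integral do rewrite /slab EFinM.
rewrite ge0_integralZl//; last 3 first.
- apply/measurable_EFinP; apply: measurable_funTS.
  exact: (measurable_slab_shape delta).
- by move=> x _; rewrite lee_fin powR_ge0.
- by rewrite lee_fin ltW// slab_const_gt0.
rewrite integral_slab_shape_itv ?gt_eqF// -EFinM lee_fin slab_constE//.
have -> : 1 + ((1 + z) * 2 `^ delta^-1 - 1) = (1 + z) * 2 `^ delta^-1 by ring.
rewrite powRM ?powR_ge0 ?(ltW z1)// -powRrM mulrN mulVf ?gt_eqF//.
rewrite powR_inv1//; set P := (1 + z) `^ _.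
have -> : delta / 2 * ((P - P * 2^-1) / delta) = P / 4 by field; rewrite gt_eqF.
by [].
Qed.

(** The integral is split at [|x| = z]. Inside, [phi * a <= 2 alpha g <= 232 alpha * slab] leaves a
    truncated slab moment. Outside, the weight is bounded by 1, and [z ^ 2 = 8 T] is the level at
    which the Gaussian tail yields [expR (- T)]. *)
Lemma null_weight_powR_le (alpha q z T : R) : 0 <= alpha <= 1 / 2 ->
  2 * delta < q <= 2 -> 0 < z -> 8 * T = z ^+ 2 ->
  (\int[mu]_x (phi x * (slab_weight delta alpha x * (1 + `|x|) `^ q))%:E <=
   (232 * alpha * (1 + z) `^ (q - delta) + 16 * expR (- T))%:E)%E.
Proof.
move=> a2 /andP[dq q2] z0 Tz.
have a01 : 0 <= alpha <= 1 by lra.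
pose k (x : RR) : R := delta / 2 * slab_shape (delta - q) x.
have k0 x : 0 <= k x by rewrite mulr_ge0 ?powR_ge0//; move: d0; lra.
have mk : measurable_fun [set: RR] k.
  by apply: measurable_funM => //; exact: (measurable_slab_shape (delta - q)).
pose A : set RR := [set` `[- z, 0%R]]; pose B : set RR := [set` `[0%R, z]].
have mA : measurable A by exact: measurable_itv.
have mB : measurable B by exact: measurable_itv.
have bound (x : RR) :
   phi x * (slab_weight delta alpha x * (1 + `|x : R|) `^ q) <=
   232 * alpha * (k x * \1_A x + k x * \1_B x) +
   16 * expR (- T) * normal_pdf 0 2 x.
  have /andP[w0 w1] := slab_weight01 x d0 a01.
  have y1 : 1 <= 1 + `|x : R| by rewrite lerDl.
  have [xz|zx] := leP `|x : R| z.
    have kAB : k x <= k x * \1_A x + k x * \1_B x.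
      rewrite -mulrDr ler_peMr// !indicE.
      move: xz; rewrite ler_norml => /andP[zx xz].
      have [x0|x0] := leP 0 (x : R).
        have -> : x \in B by rewrite inE /B /= in_itv /= x0.
        by rewrite lerDr.
      have -> : x \in A by rewrite inE /A /= in_itv /= zx ltW.
      by rewrite lerDl.
    apply: (@le_trans _ _ (232 * alpha * k x)).
      rewrite mulrA /k -slab_mul_powR mulrA ler_wpM2r ?powR_ge0//.
      apply: le_trans (phi_slab_weight_le d0 x a2) _.
      have := marginal_le_slab delta01 x.
      by set g := marginal _ _; set s := slab _ _ => gs; nra.
    rewrite -[leLHS]addr0 lerD//.
      by rewrite ler_wpM2l//; lra.
    by rewrite mulr_ge0 ?normal_pdf_ge0// mulr_ge0 ?expR_ge0.
  apply: (@le_trans _ _ (16 * expR (- T) * normal_pdf 0 2 x)); last first.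
    rewrite lerDr mulr_ge0//; first by lra.
    by rewrite addr_ge0// mulr_ge0// indicE.
  have h := @phi_tail_le R x T.
  have xT : 8 * T <= x ^+ 2.
    by rewrite Tz -[x ^+ 2]real_normK ?num_real//; move: zx z0; nra.
  apply: (@le_trans _ _ (phi x * (2 * (1 + x ^+ 2)))); last by move: (h xT); lra.
  rewrite ler_pM2l ?phi_gt0//; apply: (@le_trans _ _ ((1 + `|x : R|) `^ 2)).
    apply: (@le_trans _ _ ((1 + `|x : R|) `^ q)).
      by rewrite ler_piMl ?powR_ge0.
    by apply: ler_powR.
  rewrite powR_mulrn ?(le_trans ler01)// -[x ^+ 2]real_normK ?num_real//.
  by have := sqr_ge0 (1 - `|x : R|); nra.
have mkA : measurable_fun [set: RR] (fun x => (k x * \1_A x)%:E).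
  by apply/measurable_EFinP; apply: measurable_funM.
have mkB : measurable_fun [set: RR] (fun x => (k x * \1_B x)%:E).
  by apply/measurable_EFinP; apply: measurable_funM.
have mN : measurable_fun [set: RR] (fun x => (normal_pdf 0 2 x : R)%:E).
  by apply/measurable_EFinP; exact: measurable_normal_pdf.
have kA0 x : (0 <= (k x * \1_A x)%:E)%E by rewrite lee_fin mulr_ge0// indicE.
have kB0 x : (0 <= (k x * \1_B x)%:E)%E by rewrite lee_fin mulr_ge0// indicE.
have N0 x : (0 <= (normal_pdf 0 2 x : R)%:E)%E by rewrite lee_fin normal_pdf_ge0.
have c1 : (0 <= (232 * alpha)%:E)%E by rewrite lee_fin; lra.
have c2 : (0 <= (16 * expR (- T))%:E)%E by rewrite lee_fin mulr_ge0 ?expR_ge0.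
apply: (@le_trans _ _ (\int[mu]_x ((232 * alpha)%:E *
   ((k x * \1_A x)%:E + (k x * \1_B x)%:E) +
   (16 * expR (- T))%:E * (normal_pdf 0 2 x)%:E))%E).
  apply: ge0_le_integralT => x.
    have /andP[w0 w1] := slab_weight01 x d0 a01.
    by rewrite lee_fin mulr_ge0 ?phi_ge0// mulr_ge0 ?powR_ge0.
  by have := bound x; rewrite -lee_fin EFinD !EFinM EFinD.
rewrite ge0_integralD//; last 4 first.
- by move=> x _; rewrite mule_ge0// adde_ge0.
- by apply: measurable_funeM; exact: emeasurable_funD.
- by move=> x _; rewrite mule_ge0.
- exact: measurable_funeM.
rewrite ge0_integralZl//; last 2 first.
- exact: emeasurable_funD.
- by move=> x _; rewrite adde_ge0.
rewrite ge0_integralD// ge0_integralZl// integral_normal_pdf// mule1.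
rewrite !integral_mul_indic// [leRHS]EFinD leeD2r// [leRHS]EFinM lee_wpmul2l//.
have kE (D : set RR) : measurable D -> (\int[mu]_(x in D) (k x)%:E =
    (delta / 2)%:E * \int[mu]_(x in D) (slab_shape (delta - q) x)%:E)%E.
  move=> mD; under eq_integral do rewrite EFinM.
  rewrite ge0_integralZl//.
  - apply/measurable_EFinP; apply: measurable_funTS.
    exact: (measurable_slab_shape (delta - q)).
  - by move=> x _; rewrite lee_fin powR_ge0.
  - by rewrite lee_fin; move: d0; lra.
have -> : (\int[mu]_(x in A) (k x)%:E = \int[mu]_(x in B) (k x)%:E)%E.
  by rewrite !kE// integral_slab_shape_opp// ltW.
have := integral_slab_mul_powR_le dq z0; rewrite -/B => kB.
apply: le_trans (leeD kB kB) _.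
by rewrite -EFinD lee_fin -splitr.
Qed.

(** Let [I] and [J] be the expected weights under [phi] and under [g]. Detailed balance gives
    [(1 - alpha) I + alpha J = alpha], that is [I = alpha (1 + I - J)]. Here [I <= 2 alpha], while
    [J] is bounded below because a draw from [g] exceeds [z] with probability of order
    [(1 + z)^(- delta)] and then has weight at least 1/2. *)
Lemma null_weight_le (alpha z : R) : 0 < alpha <= 1 / 2 -> 0 <= z ->
  (forall x, z <= x -> 1 / 2 <= slab_weight delta alpha x) ->
  (\int[mu]_x (phi x * slab_weight delta alpha x)%:E <=
   (alpha * (1 + 2 * alpha - phi 1 / 32 * (1 + z) `^ (- delta)))%:E)%E.
Proof.
move=> a2 z0 wz.
have a01 : 0 <= alpha <= 1 by lra.
have w01 x := slab_weight01 x d0 a01.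
have g0 x : 0 <= marginal delta x by rewrite ltW// marginal_gt0.
have mg := measurable_marginal d0; have mw := measurable_slab_weight d0 a01.
have mp := @measurable_phi R.
have gw_le x : (0 <= marginal delta x * slab_weight delta alpha x <= marginal delta x).
  have /andP[w0 w1] := w01 x.
  by rewrite mulr_ge0//= ler_piMr.
have pw_le x : 0 <= phi x * slab_weight delta alpha x <= 2 * alpha * marginal delta x.
  have /andP[w0 w1] := w01 x.
  by rewrite mulr_ge0 ?phi_ge0//= phi_slab_weight_le//; lra.
set I := (X in (X <= _)%E).
set J := (\int[mu]_x (marginal delta x * slab_weight delta alpha x)%:E)%E.
have I0 : (0 <= I)%E by apply: integral_ge0 => x _; rewrite lee_fin; case/andP: (pw_le x).
have I2 : (I <= (2 * alpha)%:E)%E.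
  rewrite -[leRHS]mule1 -(integral_marginal d0) -ge0_integralZl//.
  - by apply: ge0_le_integralT => x; rewrite -?EFinM lee_fin; case/andP: (pw_le x).
  - exact/measurable_EFinP.
  - by move=> x _; rewrite lee_fin.
  - by rewrite lee_fin; lra.
have J0 : (0 <= J)%E by apply: integral_ge0 => x _; rewrite lee_fin; case/andP: (gw_le x).
have J1 : (J <= 1)%E.
  rewrite -(integral_marginal d0).
  by apply: ge0_le_integralT => x; rewrite lee_fin; case/andP: (gw_le x).
have IJ : ((1 - alpha)%:E * I + alpha%:E * J = alpha%:E)%E.
  have eZ (c : R) (f : RR -> R) : 0 <= c -> measurable_fun setT f -> (forall x, 0 <= f x) ->
      (c%:E * \int[mu]_x (f x)%:E = \int[mu]_x (c%:E * (f x)%:E))%E.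
    move=> c0 mf f0; rewrite ge0_integralZl//; first exact/measurable_EFinP.
    by move=> x _; rewrite lee_fin.
  have a1 : 0 <= 1 - alpha by lra.
  have a0 : 0 <= alpha by lra.
  have eI := eZ _ _ a1 (measurable_funM mp mw) (fun x => proj1 (andP (pw_le x))).
  have eJ := eZ _ _ a0 (measurable_funM mg mw) (fun x => proj1 (andP (gw_le x))).
  rewrite -[RHS]mule1 -(integral_marginal d0) (eZ _ _ a0 mg g0) /I /J.
  rewrite [X in (X + _)%E]eI [X in (_ + X)%E]eJ.
  rewrite -ge0_integralD//; last 4 first.
  - move=> x _; rewrite -EFinM lee_fin mulr_ge0//.
    by case/andP: (pw_le x).
  - by apply: measurable_funeM; apply/measurable_EFinP; exact: measurable_funM.
  - move=> x _; rewrite -EFinM lee_fin mulr_ge0//.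
    by case/andP: (gw_le x).
  - by apply: measurable_funeM; apply/measurable_EFinP; exact: measurable_funM.
  apply: eq_integral => x _; rewrite -!EFinM -EFinD slab_weight_detailed_balance//.
  by rewrite /=; congr EFin; ring.
have [w zw Pw] := slab_tail_ge z0.
have Jge : ((phi 1 / 32 * (1 + z) `^ (- delta))%:E <= J)%E.
  apply: (@le_trans _ _ ((phi 1 / 8)%:E * \int[mu]_(x in `[z, w]) (slab delta x)%:E)%E).
    apply: le_trans (lee_wpmul2l _ Pw); last first.
      by rewrite lee_fin divr_ge0 ?phi_ge0.
    by rewrite -EFinM lee_fin; move: (_ `^ _) (phi 1) => *; lra.
  rewrite -ge0_integralZl//; last 3 first.
  - by apply/measurable_EFinP; apply: measurable_funTS; exact: measurable_slab.
  - by move=> x _; rewrite lee_fin slab_ge0.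
  - by rewrite lee_fin divr_ge0 ?phi_ge0.
  rewrite [leLHS]integral_mkcond; apply: ge0_le_integralT => x.
    rewrite patchE; case: ifP => // _.
    by rewrite -EFinM lee_fin mulr_ge0 ?slab_ge0// divr_ge0 ?phi_ge0.
  rewrite patchE; case: ifPn; last first.
    by rewrite lee_fin; case/andP: (gw_le x).
  rewrite inE /= in_itv /= => /andP[zx _]; rewrite -EFinM lee_fin.
  have -> : phi 1 / 8 * slab delta x = phi 1 / 4 * slab delta x * (1 / 2) by field.
  rewrite ler_pM ?wz ?slab_le_marginal//.
  by rewrite mulr_ge0 ?slab_ge0// divr_ge0 ?phi_ge0.
move: IJ I2 J1 Jge I0 J0; case: I => [i||//]; case: J => [j||//] //.
rewrite -!EFinM -EFinD !lee_fin => -[IJ] I2 J1 Jge I0 J0.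
move: Jge; set t := phi 1 / 32 * _ => Jge.
have a0 : 0 <= alpha by lra.
have := ler_wpM2l a0 Jge; have := ler_wpM2l a0 I2.
lra.
Qed.

End moments.
End slab_integrals.

(** * The marginal likelihood estimator *)

Section mmle.
Context {R : realType}.
Context (delta : R).
Hypothesis delta0 : 0 < delta.

Lemma ln_le_subr1 (y : R) : 0 < y -> ln y <= y - 1.
Proof.
move=> y0; have := expR_ge1Dx (ln y); rewrite lnK ?posrE//.
by move: (ln y) => l; lra.
Qed.

Lemma log_marginalE n (x : vec R n) (alpha : R) :
  log_marginal delta x alpha = \sum_(i < n) ln (mixture delta alpha (tnth x i)).
Proof. by []. Qed.

(** The log-likelihood is concave in alpha: by [ln y <= y - 1], its increment from [alpha] to [beta]
    is at most [beta - alpha] times the score [\sum_i D i] at [alpha]. Moreover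
    [a - alpha = alpha (1 - alpha) D]. *)
Lemma sum_slab_weight_ge0 n (x : vec R n) (alpha beta : R) :
  0 <= alpha -> alpha < beta -> beta <= 1 ->
  log_marginal delta x alpha <= log_marginal delta x beta ->
  0 <= \sum_(i < n) (slab_weight delta alpha (tnth x i) - alpha).
Proof.
move=> a0 ab b1; rewrite !log_marginalE -subr_ge0 -sumrB => h.
have a01 : 0 <= alpha <= 1 by lra.
have b01 : 0 <= beta <= 1 by lra.
pose D i := (marginal delta (tnth x i) - phi (tnth x i)) / mixture delta alpha (tnth x i).
have hD : 0 <= (beta - alpha) * \sum_(i < n) D i.
  apply: le_trans h _; rewrite mulr_sumr; apply: ler_sum => i _.
  have fa := mixture_gt0 delta0 a01 (tnth x i).
  have fb := mixture_gt0 delta0 b01 (tnth x i).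
  rewrite -ln_div ?posrE//; apply: le_trans (ln_le_subr1 _) _.
    by rewrite divr_gt0.
  rewrite -[X in _ - X](divff (lt0r_neq0 fa)) -mulrBl mulrA /mixture.
  by rewrite ler_pM2r ?invr_gt0//; lra.
have D0 : 0 <= \sum_(i < n) D i by move: hD; rewrite pmulr_rge0// subr_gt0.
have -> : \sum_(i < n) (slab_weight delta alpha (tnth x i) - alpha) =
    alpha * (1 - alpha) * \sum_(i < n) D i.
  rewrite mulr_sumr; apply: eq_bigr => i _.
  have fa := mixture_gt0 delta0 a01 (tnth x i).
  rewrite slab_weightE /D.
  rewrite -[X in _ - X](mulfK (lt0r_neq0 fa)) -mulrBl mulrA.
  by congr (_ / _); rewrite /mixture; ring.
by rewrite mulr_ge0// mulr_ge0//; lra.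
Qed.

(** This is the first-order condition at the maximiser in the direction of 1. The point
    [beta = alpha + h (1 - alpha)] stays in the interval even when [alpha] is its left end, and it
    turns the mixture [f] into [f + h (g - f)]. In place of a derivative,
    [ln (1 + z) >= z - 2 z ^ 2] for [z >= - 1 / 2] is summed over the coordinates, and [h] is then
    chosen small. *)
Lemma sum_marginal_ratio_le n (x : vec R n) (alpha0 alpha : R) :
  0 <= alpha0 -> alpha0 <= alpha <= 1 ->
  (forall beta, alpha0 <= beta <= 1 ->
     log_marginal delta x beta <= log_marginal delta x alpha) ->
  \sum_(i < n) marginal delta (tnth x i) / mixture delta alpha (tnth x i) <= n%:R.
Proof.
move=> a00 /andP[a0a a1] hmax.
have a01 : 0 <= alpha <= 1 by rewrite a1 (le_trans a00).
have f0 i := mixture_gt0 delta0 a01 (tnth x i).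
have g0 i := marginal_gt0 (tnth x i) delta0.
have [->|an1] := eqVneq alpha 1.
  rewrite (eq_bigr (fun=> 1)) ?sumr_const ?card_ord// => i _.
  by rewrite /mixture subrr mul0r add0r mul1r divff// gt_eqF.
have alt1 : alpha < 1 by rewrite lt_neqAle an1.
pose y i := marginal delta (tnth x i) / mixture delta alpha (tnth x i) - 1.
have yN1 i : - 1 <= y i by rewrite /y lerBrDl subrr divr_ge0 ?ltW.
suff y0 : \sum_(i < n) y i <= 0.
  move: y0; rewrite sumrB sumr_const card_ord subr_le0.
  by [].
have small h : 0 < h <= 1 / 2 -> \sum_(i < n) y i <= 2 * h * \sum_(i < n) y i ^+ 2.
  move=> h12; pose beta := alpha + h * (1 - alpha).
  have b01 : alpha0 <= beta <= 1 by rewrite /beta; apply/andP; split; nra.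
  have := hmax _ b01; rewrite !log_marginalE -subr_le0 -sumrB => hb.
  have b01' : 0 <= beta <= 1 by move: b01; lra.
  have hy i : ln (mixture delta beta (tnth x i)) - ln (mixture delta alpha (tnth x i)) >=
      h * y i - 2 * h ^+ 2 * y i ^+ 2.
    have fb := mixture_gt0 delta0 b01' (tnth x i).
    rewrite -ln_div ?posrE// -[ln _]opprK -lnV ?posrE ?divr_gt0//.
    have e : mixture delta beta (tnth x i) / mixture delta alpha (tnth x i) = 1 + h * y i.
      have fn := lt0r_neq0 (f0 i).
      have -> : mixture delta beta (tnth x i) = mixture delta alpha (tnth x i) +
          h * (marginal delta (tnth x i) - mixture delta alpha (tnth x i)).
        by rewrite /mixture /beta; ring.
      by rewrite /y; move: (mixture _ _ _) fn => f fn; field.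
    rewrite e; have hy0 : 1 / 2 <= 1 + h * y i by have := yN1 i; nra.
    have hyp : 0 < 1 + h * y i by lra.
    rewrite lerNr; apply: le_trans (ln_le_subr1 _) _; first by rewrite invr_gt0.
    rewrite lerBlDr -[leLHS]mul1r ler_pdivrMr//.
    set z := h * y i in hy0 hyp *.
    have -> : 2 * h ^+ 2 * y i ^+ 2 = 2 * z ^+ 2 by rewrite /z; ring.
    have : 0 <= z ^+ 2 * (2 * z + 1) by rewrite mulr_ge0 ?sqr_ge0//; lra.
    by nra.
  have : \sum_(i < n) (h * y i - 2 * h ^+ 2 * y i ^+ 2) <= 0.
    by apply: le_trans hb; apply: ler_sum => i _; exact: hy.
  rewrite sumrB -!mulr_sumr.
  set Y := \sum_(i < n) y i; set Q := \sum_(i < n) y i ^+ 2 => YQ.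
  have h0 : 0 < h by lra.
  have : h * (Y - 2 * h * Q) <= 0
    by apply: le_trans YQ; rewrite le_eqVlt; apply/orP; left; apply/eqP; ring.
  by rewrite pmulr_rle0// subr_le0.
have Q0 : 0 <= \sum_(i < n) y i ^+ 2 by apply: sumr_ge0 => i _; exact: sqr_ge0.
move: small Q0; set Y := \sum_(i < n) y i; set Q := \sum_(i < n) y i ^+ 2 => small Q0.
rewrite leNgt; apply/negP => Y0.
have D0 : 0 < 4 * Q + 1 by lra.
(* With [h = Y / (4 Q + 1)] the bound reads [Y <= Y * 2 Q / (4 Q + 1) < Y]. If this [h] is at least
   1/2, then [h = 1 / 2] gives [Y <= Q], against [Y >= 2 Q + 1 / 2]. *)
have [big|sml] := leP (1 / 2) (Y / (4 * Q + 1)).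
  have h2 := small (1 / 2); have : Y <= 2 * (1 / 2) * Q by apply: h2; lra.
  by move: big; rewrite ler_pdivlMr//; lra.
have hY : 0 < Y / (4 * Q + 1) by rewrite divr_gt0.
have := small (Y / (4 * Q + 1)).
rewrite hY ltW// => /(_ isT).
have -> : 2 * (Y / (4 * Q + 1)) * Q = Y * (2 * Q / (4 * Q + 1)) by field; rewrite gt_eqF.
rewrite -[leLHS]mulr1 ler_pM2l// ler_pdivlMr//; lra.
Qed.

End mmle.

(** * Weight of the atom at a signal *)

Section signal.
Context {R : realType}.
Context (delta : R).
Hypothesis delta01 : 0 < delta <= 1.

Let d0 : 0 < delta. Proof. by case/andP: delta01. Qed.

Lemma ln_slab_ge (x : R) : - ln (slab delta x) <= ln (2 / delta) + 2 * `|x|.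
Proof.
have X0 := slab_shape_arg_gt0 x; have := delta01 => d01.
rewrite /slab lnM ?posrE ?slab_const_gt0 ?powR_gt0// slab_constE// /slab_shape.
rewrite ln_powR opprD lerD//; first by rewrite -lnV ?posrE ?divr_gt0// invf_div.
rewrite -mulNr; have : ln (1 + `|x|) <= `|x|.
  by have := ln_le_subr1 X0; rewrite addrAC subrr add0r.
have : 0 <= ln (1 + `|x|) by rewrite ln_ge0// lerDl.
have := normr_ge0 x; nra.
Qed.

Lemma ln_phi_le (x : R) : ln (phi x) <= - (x ^+ 2 / 2).
Proof.
rewrite phiE lnM ?posrE ?expR_gt0 ?normal_peak_gt0 ?oner_neq0//.
by rewrite expRK gerDr ln_le0 ?normal_peak1_le1.
Qed.

(* [r] stands for s / n and [T] for ln (n / s). *)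
Lemma signal_weight_sqr_le (alpha x r T : R) : 0 <= alpha <= 1 -> 0 < r ->
  0 <= T -> ln r = - T ->
  (1 - slab_weight delta alpha x) * x ^+ 2 <=
  4 * (5 + ln (4 / phi 1) + ln (2 / delta) + T +
       r * (marginal delta x / mixture delta alpha x)).
Proof.
move=> a01 r0 T0 lnr.
have g0 := marginal_gt0 x d0; have f0 := mixture_gt0 d0 a01 x.
have p0 := phi_gt0 x; have p1 := @phi_gt0 R 1; have p11 := @phi_le1 R 1.
have /andP[w0 w1] := slab_weight01 x d0 a01.
have L0 : 0 <= ln (4 / phi 1 : R).
  by rewrite ln_ge0// ler_pdivlMr//; lra.
have L1 : 0 <= ln (2 / delta).
  by rewrite ln_ge0// ler_pdivlMr//; move: delta01; lra.
set w := marginal delta x / mixture delta alpha x.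
have wp : 0 < w by rewrite divr_gt0.
have rw : 0 < r * w by rewrite mulr_gt0.
set y := 1 - slab_weight delta alpha x.
have y0 : 0 <= y by rewrite subr_ge0.
have y1 : y <= 1 by rewrite gerBl.
have [yE|yn0] := eqVneq y 0; first by rewrite yE mul0r; lra.
have yp : 0 < y by rewrite lt_neqAle eq_sym yn0.
have yle : y <= phi x / marginal delta x * w.
  rewrite /w mulrA divfK ?gt_eqF// /y onem_slab_weight//.
  by rewrite ler_pM2r ?invr_gt0// ler_piMl ?(ltW p0)//; lra.
have lny : ln y <= ln (phi x) - ln (marginal delta x) + ln w.
  rewrite -ln_div ?posrE// -lnM ?posrE ?divr_gt0//.
  by rewrite ler_ln ?posrE ?mulr_gt0 ?invr_gt0.
have lng : - ln (marginal delta x) <= ln (4 / phi 1) + ln (2 / delta) + 2 * `|x|.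
  have s0 := slab_gt0 d0 x.
  have : ln (phi 1 / 4 * slab delta x) <= ln (marginal delta x).
    by rewrite ler_ln ?posrE ?slab_le_marginal// mulr_gt0// divr_gt0.
  rewrite lnM ?posrE ?divr_gt0//.
  have -> : ln (phi 1 / 4) = - ln (4 / phi 1 : R).
    by rewrite -lnV ?posrE ?divr_gt0// invf_div.
  by have := ln_slab_ge x; lra.
(* The logarithm is linearised at scale [r] because the sum of [r * w] over the coordinates is at
   most [r * n = s]. *)
have lnw : ln w <= T + r * w.
  have := ln_le_subr1 rw; rewrite lnM ?posrE// lnr; lra.
(* The bound on [x ^ 2] contains [- ln y], which is unbounded for small [y]; multiplied by [y] it is
   harmless. *)
have ylny : - (y * ln y) <= 1.
  have := @ln_le_subr1 R y^-1; rewrite invr_gt0 => /(_ yp); rewrite lnV ?posrE// => h.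
  rewrite -mulrN; apply: (@le_trans _ _ (y * (y^-1 - 1))).
    by rewrite ler_wpM2l.
  by rewrite mulrBr divff// mulr1; lra.
have lnp := ln_phi_le x.
have x2 : 2 * `|x| <= x ^+ 2 / 4 + 4.
  by rewrite -[x ^+ 2]real_normK ?num_real//; have := sqr_ge0 (`|x| - 4); nra.
set K := 4 + ln (4 / phi 1) + ln (2 / delta) + T + r * w.
have K0 : 0 <= K by rewrite /K; lra.
have h : x ^+ 2 / 4 <= K - ln y by rewrite /K; lra.
have := ler_wpM2l y0 h; rewrite mulrBr.
have : y * K <= K by rewrite ler_piMl.
rewrite /K; lra.
Qed.

End signal.

(** * Posterior median at a large observation *)

Section threshold.
Context {R : realType}.
Local Notation RR := (measurableTypeR R).
Local Notation mu := (@lebesgue_measure R).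
Context (delta : R).
Hypothesis delta01 : 0 < delta <= 1.

Let d0 : 0 < delta. Proof. by case/andP: delta01. Qed.

Lemma measurable_sqr_dist1 (x : R) :
  measurable_fun [set: RR] (fun u : RR => 1 + ((u : R) - x) ^+ 2 : R).
Proof.
by apply: measurable_funD => //; apply: measurable_funX; exact: measurable_funB.
Qed.

(** The slab at [x] cancels between the upper bound of the numerator and the lower bound of [g], so
    the spread of the slab posterior around [x] is bounded uniformly in [x] and [delta];
    [464 = 4 * 116]. *)
Lemma integral_slab_post_moment_le (x : R) :
  (\int[mu]_u ((1 + (u - x) ^+ 2)%:E * (slab_post delta x u)%:E) <=
   (464 / phi 1)%:E)%E.
Proof.
have g0 := marginal_gt0 x d0; have p1 := @phi_gt0 R 1.
have s0 := slab_gt0 d0 x.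
rewrite (eq_integral (fun u : RR => ((phi (x - u) * slab delta u *
    (1 + (u - x) ^+ 2))%:E * ((marginal delta x)^-1)%:E)%E)); last first.
  by move=> u _; rewrite -!EFinM /slab_post; congr EFin; ring.
rewrite ge0_integralZr//; last 3 first.
- apply/measurable_EFinP; apply: measurable_funM; first exact: measurable_joint.
  exact: measurable_sqr_dist1.
- by move=> u _; rewrite lee_fin joint_moment_ge0.
- by rewrite lee_fin invr_ge0 ltW.
apply: (@le_trans _ _ ((116 * slab delta x)%:E * ((marginal delta x)^-1)%:E)%E).
  rewrite lee_wpmul2r ?integral_joint_moment_le//.
  by rewrite lee_fin invr_ge0 ltW.
rewrite -EFinM lee_fin ler_pdivrMr// mulrAC ler_pdivlMr//.
by have := slab_le_marginal delta01 x; lra.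
Qed.

Lemma slab_post_prob_le (x r : R) (A : set RR) : 0 < r -> measurable A ->
  (forall u : R, A u -> r <= 1 + (u - x) ^+ 2) ->
  (\int[mu]_(u in A) (slab_post delta x u)%:E <= (464 / phi 1 / r)%:E)%E.
Proof.
move=> r0 mA Ar.
apply: (@le_trans _ _ (\int[mu]_u ((1 + (u - x) ^+ 2)%:E *
   (slab_post delta x u)%:E * (r^-1)%:E))%E).
  rewrite integral_mkcond; apply: ge0_le_integralT => u.
    by rewrite patchE; case: ifP => // _; rewrite lee_fin slab_post_ge0.
  have sp := slab_post_ge0 x d0 u.
  rewrite patchE -!EFinM; case: ifPn => [/[!inE] Au|_]; rewrite lee_fin.
    by rewrite ler_pdivlMr// mulrC ler_wpM2r// Ar.
  by rewrite mulr_ge0 ?invr_ge0 ?(ltW r0)// mulr_ge0// addr_ge0// sqr_ge0.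
rewrite ge0_integralZr//; last 3 first.
- apply: emeasurable_funM; apply/measurable_EFinP.
    exact: measurable_sqr_dist1.
  exact: measurable_slab_post.
- by move=> u _; rewrite -EFinM lee_fin mulr_ge0 ?slab_post_ge0// addr_ge0// sqr_ge0.
- by rewrite lee_fin invr_ge0 ltW.
rewrite [leRHS]EFinM lee_wpmul2r ?integral_slab_post_moment_le//.
by rewrite lee_fin invr_ge0 ltW.
Qed.

(** Below 1 the posterior has at most mass [1/4] from the atom and [1/8] from the slab, by Markov
    with [3712 = 8 * 464]: less than one half in all. A nonzero median at [t] will contradict the
    definition of the threshold. *)
Lemma posterior_median_ge1 (alpha t : R) : 0 <= alpha <= 1 -> 1 <= t ->
  3 / 4 <= slab_weight delta alpha t -> 3712 / phi 1 <= 1 + (t - 1) ^+ 2 ->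
  1 <= posterior_median delta alpha t.
Proof.
move=> a01 t1 w34 tK; have p1 := @phi_gt0 R 1.
have /andP[w0 w1] := slab_weight01 t d0 a01.
have cE (A : set RR) : coord_posterior delta alpha t A =
    ((1 - slab_weight delta alpha t)%:E * @dirac _ RR 0%R R A +
     (slab_weight delta alpha t)%:E * \int[mu]_(u in A) (slab_post delta t u)%:E)%E.
  by rewrite /coord_posterior d0 a01.
have sp0 (A : set RR) : (0 <= \int[mu]_(u in A) (slab_post delta t u)%:E)%E.
  by apply: integral_ge0 => u _; rewrite lee_fin slab_post_ge0.
rewrite /posterior_median; apply: lb_le_inf.
  (* The lower bound on [inf] requires a nonempty set. As [928 = 2 * 464], at most half of the slab
     mass lies above [t + M], so this point is in the set. *)
  pose M : R := 928 / phi 1; pose B : set RR := [set` `]-oo, (t + M)%R]].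
  have mB : measurable B by exact: measurable_itv.
  exists (t + M) => /=.
  have M1 : 928 <= M by rewrite /M ler_pdivlMr//; have := @phi_le1 R 1; lra.
  rewrite -[X in (_ <= coord_posterior _ _ _ X)%E]setCK.
  have mC := measurableC mB.
  rewrite [leRHS](probability_setC (coord_posterior delta alpha t) mC).
  have : (coord_posterior delta alpha t (~` B) <= (1 / 2)%:E)%E.
    rewrite cE diracE memNset; last first.
      by rewrite /B /= in_itv /=; apply: contra_notP => _; lra.
    rewrite mule0 add0e.
    apply: (@le_trans _ _ (1 * \int[mu]_(u in ~` B) (slab_post delta t u)%:E)%E).
      by rewrite lee_wpmul2r// lee_fin.
    rewrite mul1e; apply: le_trans (slab_post_prob_le (r := M) _ mC _) _.
    - by lra.
    - move=> u; rewrite /B /= in_itv /= => /negP; rewrite -ltNge => ut.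
      have uM : M < u - t by lra.
      have : 0 <= (u - t) * (u - t - 1) by apply: mulr_ge0; lra.
      by rewrite expr2; lra.
    - by rewrite lee_fin /M invf_div mulrA divfK ?gt_eqF//; lra.
  move=> hC; apply: (@le_trans _ _ (1 - (1 / 2)%:E)%E).
    by rewrite -EFinB lee_fin; lra.
  exact: leeB.
move=> u /= hu; rewrite leNgt; apply/negP => u1; move: hu; apply/negP.
rewrite -ltNge cE.
set A : set RR := [set` `]-oo, u]].
have mA : measurable A by exact: measurable_itv.
have P1 : (\int[mu]_(u in A) (slab_post delta t u)%:E <= (1 / 8)%:E)%E.
  apply: le_trans (slab_post_prob_le (r := 3712 / phi 1) _ mA _) _.
  - by apply: divr_gt0; [rewrite ltr0n|].
  - move=> v; rewrite /A /= in_itv /= => vu; apply: le_trans tK _.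
    by rewrite lerD2l -[(v - t) ^+ 2]sqrrN opprB ler_sqr ?nnegrE; lra.
  - by rewrite lee_fin invf_div mulrA divfK ?gt_eqF//; lra.
apply: (@le_lt_trans _ _ ((1 / 4)%:E * 1 + 1 * (1 / 8)%:E)%E).
  apply: leeD.
    apply: lee_pmul.
    - by rewrite lee_fin; lra.
    - by rewrite diracE; case: (_ \in _); rewrite lee_fin.
    - by rewrite lee_fin; lra.
    - by rewrite diracE; case: (_ \in _); rewrite lee_fin.
  by apply: lee_pmul => //; rewrite lee_fin.
by rewrite mule1 mul1e -EFinD lte_fin; lra.
Qed.

End threshold.

(** * Risk of one coordinate *)

Section elementary.
Context {R : realType}.

Lemma powR_le1D (y p : R) : 0 <= y -> 0 <= p <= 1 -> y `^ p <= 1 + y.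
Proof.
move=> y0 /andP[p0 p1]; have [y1|/ltW y1] := leP y 1.
  apply: (@le_trans _ _ 1); last by rewrite lerDl.
  by have := ge0_ler_powR p0 y0 (ler01 : 1 \is Num.nneg) y1; rewrite powR1.
apply: (@le_trans _ _ y); last by rewrite lerDr.
by rewrite -[leRHS]powRr1//; apply: ler_powR.
Qed.

Lemma powR_le_sqr (y q : R) : 0 <= q <= 2 -> (1 + `|y|) `^ q <= 2 * (1 + y ^+ 2).
Proof.
move=> /andP[q0 q2]; apply: (@le_trans _ _ ((1 + `|y|) `^ 2)).
  by apply: ler_powR; rewrite // lerDl.
rewrite powR_mulrn ?addr_ge0// -[y ^+ 2]real_normK ?num_real//.
by have := sqr_ge0 (1 - `|y|); lra.
Qed.

(** Reduces every [q] to the quadratic case, with the target rate [T^(q / 2)] as a factor. *)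
Lemma norm_powR_le (x T q : R) : 0 < T -> 0 <= q <= 2 ->
  `|x| `^ q <= T `^ (q / 2) * (1 + x ^+ 2 / T).
Proof.
move=> T0 q02; have -> : `|x| `^ q = T `^ (q / 2) * (x ^+ 2 / T) `^ (q / 2).
  rewrite -powRM ?(ltW T0) ?divr_ge0 ?sqr_ge0 ?(ltW T0)//.
  rewrite mulrCA divff ?gt_eqF// mulr1 -[x ^+ 2]real_normK ?num_real//.
  rewrite -powR_mulrn// -powRrM; congr (_ `^ _).
  by rewrite mulrCA divff ?mulr1.
rewrite ler_wpM2l ?powR_ge0//; apply: powR_le1D; last by lra.
by rewrite divr_ge0 ?sqr_ge0 ?(ltW T0).
Qed.

Lemma norm_powR_dist_le (x theta q : R) : 0 <= q <= 2 ->
  `|theta| `^ q <= 4 * `|x| `^ q + 4 * (1 + `|x - theta|) `^ q.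
Proof.
move=> /andP[q0 q2].
have le4 (a b : R) : 0 <= a -> 0 <= b -> a <= 2 * b -> a `^ q <= 4 * b `^ q.
  move=> a0 b0 ab; apply: (@le_trans _ _ ((2 * b) `^ q)).
    by apply: ge0_ler_powR; rewrite // nnegrE// mulr_ge0.
  rewrite powRM// ler_wpM2r ?powR_ge0//.
  have -> : 4 = 2 `^ 2 :> R by rewrite powR_mulrn//; lra.
  by apply: ler_powR => //; lra.
have tri : `|theta| <= `|x| + `|x - theta|.
  by rewrite -{1}(subKr x theta) ler_normB.
have [h|h] := leP `|x - theta| `|x|.
  by rewrite -[leLHS]addr0 lerD ?mulr_ge0 ?powR_ge0// le4//; lra.
rewrite -[leLHS]add0r lerD ?mulr_ge0 ?powR_ge0// le4//.
by have := normr_ge0 (x - theta); lra.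
Qed.

Lemma expR_le_quadratic (y : R) : 0 <= y <= 1 / 2 -> expR y <= 1 + y + 2 * y ^+ 2.
Proof.
move=> y2; have e0 := expR_gt0 y.
have : 1 - y <= expR (- y) by exact: expR_ge1Dx.
rewrite expRN -[leRHS]div1r ler_pdivlMr// => h.
have : expR y <= (1 - y)^-1 by rewrite -[leRHS]div1r ler_pdivlMr; lra.
move=> /le_trans; apply; rewrite -[leLHS]div1r ler_pdivrMr; last by lra.
have : 0 <= y ^+ 2 * (1 - 2 * y) by rewrite mulr_ge0 ?sqr_ge0//; lra.
by lra.
Qed.

Lemma slab_weight_le (delta alpha beta x : R) : 0 < delta -> 0 <= alpha ->
  alpha <= beta -> beta <= 1 ->
  slab_weight delta alpha x <= slab_weight delta beta x.
Proof.
move=> d0 a0 ab b1.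
have fa : 0 < mixture delta alpha x by apply: mixture_gt0 => //; lra.
have fb : 0 < mixture delta beta x by apply: mixture_gt0 => //; lra.
have g0 := marginal_gt0 x d0; have p0 := phi_gt0 x.
rewrite !slab_weightE ler_pdivrMr// mulrAC ler_pdivlMr// /mixture.
move: (phi x) (marginal _ x) p0 g0 => p g p0 g0.
have : 0 <= (beta - alpha) * (g * p) by apply: mulr_ge0; [lra|rewrite mulr_ge0// ltW].
lra.
Qed.

End elementary.

Section coordinate_risk.
Context {R : realType}.
Local Notation RR := (measurableTypeR R).
Local Notation mu := (@lebesgue_measure R).
Context (delta : R).
Hypothesis delta01 : 0 < delta <= 1.

Let d0 : 0 < delta. Proof. by case/andP: delta01. Qed.

(** The atom costs [|theta|^q]. For the slab part, [|u - theta| <= (1 + |x - theta|) (1 + |u - x|)]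
    separates the noise from the posterior spread, which has a bounded second moment. *)
Lemma coord_risk_le (alpha q x theta K : R) : 0 <= alpha <= 1 ->
  0 <= q <= 2 -> K = 464 / phi 1 ->
  (\int[coord_posterior delta alpha x]_u (`|(u : R) - theta| `^ q)%R%:E <=
   ((1 - slab_weight delta alpha x) * `|theta| `^ q +
    slab_weight delta alpha x * (2 * K * (1 + `|x - theta|) `^ q))%:E)%E.
Proof.
move=> a01 q02 KE.
rewrite integral_coord_posterior//; last first.
  by apply/measurable_EFinP; exact: measurable_dist_powR.
have /andP[w0 w1] := slab_weight01 x d0 a01.
rewrite [leRHS]EFinD; apply: leeD.
  by rewrite -EFinM lee_fin sub0r normrN.
rewrite [leRHS]EFinM; apply: lee_wpmul2l; first by rewrite lee_fin.
set D := (1 + `|x - theta|) `^ q.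
have D0 : 0 <= D by exact: powR_ge0.
apply: (@le_trans _ _ (\int[mu]_u ((2 * D)%:E *
    ((1 + (u - x) ^+ 2)%:E * (slab_post delta x u)%:E)))%E).
  apply: ge0_le_integralT => u.
    by rewrite -EFinM lee_fin mulr_ge0 ?powR_ge0 ?slab_post_ge0.
  rewrite muleA -!EFinM lee_fin ler_wpM2r ?slab_post_ge0//.
  apply: (@le_trans _ _ (((1 + `|x - theta|) * (1 + `|u - x|)) `^ q)).
    apply: ge0_ler_powR; rewrite ?nnegrE ?mulr_ge0 ?addr_ge0//; first by lra.
    have : `|u - theta| <= `|u - x| + `|x - theta|.
      by apply: le_trans (ler_normD _ _); rewrite addrA subrK.
    have := mulr_ge0 (normr_ge0 (x - theta)) (normr_ge0 (u - x)).
    by lra.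
  rewrite powRM ?addr_ge0// -/D [2 * D]mulrC -mulrA ler_wpM2l//.
  exact: powR_le_sqr.
have sp0 u : 0 <= slab_post delta x u by exact: slab_post_ge0.
rewrite ge0_integralZl//; last 3 first.
- apply: emeasurable_funM; apply/measurable_EFinP.
    exact: measurable_sqr_dist1.
  exact: measurable_slab_post.
- by move=> u _; rewrite -EFinM lee_fin mulr_ge0// addr_ge0// sqr_ge0.
- by rewrite lee_fin; lra.
apply: (@le_trans _ _ ((2 * D)%:E * K%:E)%E).
  rewrite lee_wpmul2l ?lee_fin//; first by lra.
  by rewrite KE integral_slab_post_moment_le.
by rewrite -EFinM lee_fin; lra.
Qed.

Lemma normal_integral (h : RR -> R) : measurable_fun setT h -> (forall x, 0 <= h x) ->
  (\int[normal_prob 0 1]_e (h e)%:E = \int[mu]_x (phi x * h x)%:E)%E.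
Proof.
move=> mh h0; rewrite integral_normal_prob ?oner_neq0//.
- by apply: eq_integral => x _; rewrite -EFinM mulrC.
- exact/measurable_EFinP.
Qed.

Lemma integral_1Dsqr_le (c : R) (h : RR -> R) : 0 <= c -> measurable_fun setT h ->
  (forall x, 0 <= h x <= c * (1 + (x : R) ^+ 2)) ->
  (\int[normal_prob 0 1]_e (h e)%:E <= (58 * c)%:E)%E.
Proof.
move=> c0 mh hc; have h0 x : 0 <= h x by case/andP: (hc x).
rewrite normal_integral//.
apply: (@le_trans _ _ (\int[mu]_x ((58 * c)%:E * (normal_pdf 0 2 x)%:E))%E).
  apply: ge0_le_integralT => x; first by rewrite lee_fin mulr_ge0 ?phi_ge0.
  rewrite -EFinM lee_fin; apply: (@le_trans _ _ (c * (phi x * (1 + (x : R) ^+ 2) ^+ 2))).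
    rewrite mulrCA ler_wpM2l ?phi_ge0//; case/andP: (hc x) => _ /le_trans; apply.
    rewrite ler_wpM2l// expr2 ler_peMr ?addr_ge0 ?sqr_ge0//.
    by rewrite lerDl sqr_ge0.
  by rewrite -mulrA [leRHS]mulrCA ler_wpM2l// phi_poly4_le.
rewrite ge0_integralZl//.
- by rewrite integral_normal_pdf// mule1.
- by apply/measurable_EFinP; exact: measurable_normal_pdf.
- by move=> x _; rewrite lee_fin normal_pdf_ge0.
- by rewrite lee_fin; lra.
Qed.

(** Since the weight [w] satisfies [w ^ 2 <= w], [expR (lambda w) <= 1 + (lambda + 2 lambda ^ 2) w],
    so the first moment suffices. In the exponent the drift [- 4 lambda r] competes with
    [2 lambda ^ 2 alpha]; the condition [lambda * alpha <= r] lets the latter consume only half of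
    it, and this dictates the later choice of [lambda]. *)
Lemma normal_mgf_le (alpha lambda r : R) : 0 <= alpha <= 1 ->
  0 <= lambda <= 1 / 2 -> 0 <= r -> lambda * alpha <= r ->
  (\int[mu]_x (phi x * slab_weight delta alpha x)%:E <= (alpha - 4 * r)%:E)%E ->
  (\int[normal_prob 0 1]_e (expR (lambda * (slab_weight delta alpha e - alpha)))%:E
   <= (expR (- (2 * lambda * r)))%:E)%E.
Proof.
move=> a01 l2 r0 lr Ea.
have mw := measurable_slab_weight d0 a01; have mp := @measurable_phi R.
have w01 x := slab_weight01 x d0 a01.
rewrite normal_integral; last 2 first.
- apply: measurableT_comp => //; apply: measurable_funM => //.
  exact: measurable_funB.
- by move=> x; exact: expR_ge0.
set c := lambda + 2 * lambda ^+ 2.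
have c0 : 0 <= c by rewrite addr_ge0 ?mulr_ge0 ?sqr_ge0//; lra.
have l0 : 0 <= lambda by lra.
apply: (@le_trans _ _ ((expR (- (lambda * alpha)))%:E *
   (\int[mu]_x ((phi x)%:E + c%:E * (phi x * slab_weight delta alpha x)%:E)))%E).
  rewrite -ge0_integralZl//; last 2 first.
  - apply: emeasurable_funD; first exact/measurable_EFinP.
    by apply: measurable_funeM; apply/measurable_EFinP; exact: measurable_funM.
  - move=> x _; have /andP[w0 w1] := w01 x.
    by rewrite -EFinM -EFinD lee_fin addr_ge0 ?phi_ge0// mulr_ge0// mulr_ge0 ?phi_ge0.
  apply: ge0_le_integralT => x; first by rewrite lee_fin mulr_ge0 ?phi_ge0 ?expR_ge0.
  have /andP[w0 w1] := w01 x.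
  rewrite -[leRHS]/((expR (- (lambda * alpha)) *
    (phi x + c * (phi x * slab_weight delta alpha x)))%:E) lee_fin mulrBr expRD.
  set w := slab_weight delta alpha x in w0 w1 *.
  have h : expR (lambda * w) <= 1 + c * w.
    apply: le_trans (expR_le_quadratic _) _.
      by rewrite mulr_ge0//=; apply: (@le_trans _ _ lambda); [rewrite ler_piMr|lra].
    rewrite /c exprMn; have : lambda ^+ 2 * w ^+ 2 <= lambda ^+ 2 * w.
      by rewrite ler_wpM2l ?sqr_ge0// expr2 ler_piMr.
    lra.
  rewrite mulrA [leLHS]mulrC ler_wpM2l ?expR_ge0//.
  apply: (@le_trans _ _ (phi x * (1 + c * w))); last by lra.
  by rewrite ler_wpM2l ?phi_ge0.
rewrite ge0_integralD//; last 4 first.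
- by move=> x _; rewrite lee_fin phi_ge0.
- exact/measurable_EFinP.
- move=> x _; have /andP[w0 w1] := w01 x.
  by rewrite -EFinM lee_fin mulr_ge0// mulr_ge0 ?phi_ge0.
- by apply: measurable_funeM; apply/measurable_EFinP; exact: measurable_funM.
rewrite [X in (_ * (X + _))%E]integral_normal_pdf ?oner_neq0//.
rewrite ge0_integralZl//; last 2 first.
- by apply/measurable_EFinP; exact: measurable_funM.
- by move=> x _; have /andP[w0 w1] := w01 x; rewrite lee_fin mulr_ge0 ?phi_ge0.
apply: (@le_trans _ _ ((expR (- (lambda * alpha)))%:E *
   (1 + c%:E * (alpha - 4 * r)%:E))%E).
  rewrite lee_wpmul2l ?lee_fin ?expR_ge0// leeD2l// lee_wpmul2l// lee_fin//.
rewrite -[leLHS]/((expR (- (lambda * alpha)) * (1 + c * (alpha - 4 * r)))%:E) lee_fin.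
apply: (@le_trans _ _ (expR (- (lambda * alpha)) * expR (c * (alpha - 4 * r)))).
  by rewrite ler_wpM2l ?expR_ge0// expR_ge1Dx.
rewrite -expRD ler_expR /c.
have := ler_wpM2l l0 lr.
have := mulr_ge0 (sqr_ge0 lambda) r0.
lra.
Qed.

End coordinate_risk.

(** * Null coordinates at the level [alpha1] *)

Section null_coordinates.
Context {R : realType}.
Local Notation RR := (measurableTypeR R).
Local Notation mu := (@lebesgue_measure R).

(* Below [r] stands for s / n, [T] for ln (n / s) and [alpha1] for the level that
   the estimated weight exceeds only with very small probability. *)
Context (delta r T A P alpha1 : R).
Hypothesis delta01 : 0 < delta <= 1.
Hypothesis T1 : 1 <= T.
Hypothesis TE : expR (- T) = r.
Hypothesis PE : P = T `^ (delta / 2).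
Hypothesis AE : A = 1024 / phi 1.
Hypothesis alpha1E : alpha1 = A * r * P.
Hypothesis small : 2 * A * r * P ^+ 2 <= phi 1 / 256.
Hypothesis large : 1 <= 8 * delta * P.

Let d0 : 0 < delta. Proof. by case/andP: delta01. Qed.
Let p1 : 0 < phi 1 :> R. Proof. exact: phi_gt0. Qed.
Let p1' : phi 1 <= 1 :> R. Proof. exact: phi_le1. Qed.
Let T0 : 0 < T. Proof. by apply: lt_le_trans T1. Qed.

Lemma regime_r_gt0 : 0 < r. Proof. by rewrite -TE expR_gt0. Qed.

Lemma regime_A_ge : 1024 <= A.
Proof. by rewrite AE ler_pdivlMr//; have := p1'; lra. Qed.

Lemma regime_P_ge1 : 1 <= P.
Proof.
have := @ler_powR R T T1 0 (delta / 2); rewrite powRr0 -PE; apply.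
by move: d0; lra.
Qed.

Lemma regime_alpha1_bounds : 0 < alpha1 <= 1 / 512.
Proof.
have p0 := p1; have p0' := p1'; have t0 := T0; have r0 := regime_r_gt0.
have A0 := regime_A_ge; have P1 := regime_P_ge1.
have A0' : 0 < A by lra.
have P0 : 0 < P by lra.
have AP0 : 0 < A * r * P by rewrite !mulr_gt0.
rewrite alpha1E AP0 /=.
have : A * r * P * 1 <= A * r * P * P by rewrite ler_pM2l.
by move: small p1'; rewrite expr2; lra.
Qed.

(** At this truncation level [phi_tail_le] produces the factor [expR (- T) = r]. *)
Local Notation z := (Num.sqrt (8 * T)).

Let zE : 8 * T = z ^+ 2.
Proof. by rewrite sqr_sqrtr// mulr_ge0// ltW. Qed.

Let z0 : 0 < z. Proof. by rewrite sqrtr_gt0 mulr_gt0. Qed.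

Let sqrtT1 : 1 <= Num.sqrt T.
Proof. by rewrite -[leLHS]sqrtr1 ler_wsqrtr. Qed.

Let z_le : 1 + z <= 4 * Num.sqrt T.
Proof.
have : z <= 3 * Num.sqrt T.
  rewrite -(@ler_pXn2r _ 2)// ?nnegrE ?mulr_ge0 ?sqrtr_ge0//.
  by rewrite -zE exprMn sqr_sqrtr ?(ltW T0)//; move: T0; lra.
by move: sqrtT1; lra.
Qed.

Let powR_1z_le (p : R) : 0 <= p -> (1 + z) `^ p <= 4 `^ p * T `^ (p / 2).
Proof.
move=> p0; have -> : T `^ (p / 2) = Num.sqrt T `^ p.
  by rewrite -powR12_sqrt ?(ltW T0)// -powRrM mulrC.
rewrite -powRM ?sqrtr_ge0//.
by apply: ge0_ler_powR; rewrite // nnegrE ?addr_ge0 ?mulr_ge0 ?sqrtr_ge0.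
Qed.

Let powR_1zN_ge : 1 / (4 * P) <= (1 + z) `^ (- delta).
Proof.
have P1 := regime_P_ge1.
rewrite powRN div1r lef_pV2 ?posrE; last 2 first.
- by rewrite mulr_gt0//; lra.
- by rewrite powR_gt0// addr_gt0.
apply: le_trans (powR_1z_le (ltW d0)) _; rewrite PE ler_wpM2r ?powR_ge0//.
have : 4 `^ delta <= 4 `^ 1 :> R by apply: ler_powR; [lra|case/andP: delta01].
by rewrite powRr1.
Qed.

Lemma null_slab_weight_ge_half (x : R) : z <= x ->
  1 / 2 <= slab_weight delta alpha1 x.
Proof.
move=> zx; have p0 := p1; have p0' := p1'; have t0 := T0.
have r0 := regime_r_gt0; have P1 := regime_P_ge1.
have ab := regime_alpha1_bounds.
have x0 : 0 < x by apply: lt_le_trans zx.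
apply: slab_weight_ge => //; first by lra.
  by lra.
have x2 : 8 * T <= x ^+ 2 by rewrite zE ler_sqr ?nnegrE ?sqrtr_ge0 ?(ltW x0).
have := phi_tail_le x2; rewrite TE => tail.
have pdf1 : normal_pdf 0 2 x <= 1.
  apply: le_trans (normal_pdf_ub _ _ _) _ => //.
  by have := @normal_peak12 R; have := @normal_peak1_le1 R; have := normal_peak_ge0 (2 : R); lra.
have tail' : phi x * (1 + x ^+ 2) <= 8 * r.
  by apply: le_trans tail _; rewrite -[leRHS]mulr1 ler_wpM2l// mulr_ge0// ltW.
have s1 : slab delta 0 <= (1 + x) ^+ 2 * slab delta x.
  by apply: slab_le_ratio => //; rewrite ?normr0 ?addr0 ?mulr1 ?(gtr0_norm x0)//; lra.
have s0E : slab delta 0 = delta / 2.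
  by rewrite /slab /slab_shape normr0 addr0 powR1 mulr1 slab_constE.
have gx := slab_le_marginal delta01 x.
have sq : (1 + x) ^+ 2 <= 2 * (1 + x ^+ 2) by have := sqr_ge0 (1 - x); lra.
have y0 : 0 < (1 + x) ^+ 2 by rewrite exprn_gt0// addr_gt0.
have px := phi_gt0 x.
have h1 : phi x * (1 + x) ^+ 2 <= 16 * r.
  apply: (@le_trans _ _ (phi x * (2 * (1 + x ^+ 2)))); last by lra.
  by rewrite ler_pM2l.
(* The small slab constant [delta / 2] is compensated here: the right-hand side is [16 r] times
   [8 delta P], which [large] bounds below. *)
have aP : 16 * r <= alpha1 * (phi 1 / 4 * (delta / 2)).
  have -> : alpha1 * (phi 1 / 4 * (delta / 2)) = 16 * r * (8 * delta * P).
    by rewrite alpha1E AE; field; rewrite gt_eqF.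
  by rewrite ler_peMr// mulr_ge0// ltW.
have h2 : phi x * (1 + x) ^+ 2 <= alpha1 * marginal delta x * (1 + x) ^+ 2.
  apply: (le_trans h1); apply: (le_trans aP); rewrite -s0E.
  rewrite -[leRHS]mulrA ler_pM2l; last by lra.
  apply: (@le_trans _ _ (phi 1 / 4 * ((1 + x) ^+ 2 * slab delta x))).
    by rewrite ler_pM2l// divr_gt0.
  by rewrite mulrCA mulrC ler_pM2r.
move: h2; rewrite ler_pM2r// => h2.
have : (1 - alpha1) * phi x <= phi x by rewrite ler_piMl ?ltW//; lra.
by lra.
Qed.

(** This fixes [A]. The tail mass of the slab gains at least [alpha1 * phi 1 / (128 P)]. By [small],
    half of the gain absorbs [2 alpha1 ^ 2]; the other half, [alpha1 * phi 1 / (256 P)], equals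
    [4 r] exactly when [A = 1024 / phi 1]. *)
Lemma null_weight_regime :
  (\int[mu]_x (phi x * slab_weight delta alpha1 x)%:E <= (alpha1 - 4 * r)%:E)%E.
Proof.
have ab := regime_alpha1_bounds; have r0 := regime_r_gt0.
have P1 := regime_P_ge1; have A0 := regime_A_ge.
have ab' : 0 < alpha1 <= 1 / 2 by lra.
apply: le_trans (null_weight_le delta01 ab' (ltW z0) null_slab_weight_ge_half) _.
rewrite lee_fin.
set Z := (1 + z) `^ _.
have a0 : 0 <= alpha1 by lra.
suff h : 4 * r <= alpha1 * (phi 1 / 32 * Z - 2 * alpha1) by lra.
have hZ : phi 1 / (128 * P) <= phi 1 / 32 * Z.
  apply: (@le_trans _ _ (phi 1 / 32 * (1 / (4 * P)))).
    rewrite le_eqVlt; apply/orP; left; apply/eqP; field.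
    by rewrite gt_eqF//; lra.
  by rewrite ler_pM2l// divr_gt0.
have ha : 2 * alpha1 <= phi 1 / (256 * P).
  rewrite ler_pdivlMr; last by lra.
  rewrite alpha1E; move: small; rewrite ler_pdivlMr//; lra.
have e : 4 * r = alpha1 * (phi 1 / (256 * P)).
  rewrite alpha1E AE; field; rewrite ?gt_eqF//; lra.
rewrite e; apply: ler_wpM2l => //.
have : phi 1 / (128 * P) = 2 * (phi 1 / (256 * P)).
  by field; rewrite gt_eqF//; lra.
lra.
Qed.

Lemma null_weight_powR_regime (q : R) : 2 * delta < q <= 2 ->
  (\int[mu]_x (phi x * (slab_weight delta alpha1 x * (1 + `|x|) `^ q))%:E <=
   ((3712 * A + 16) * r * T `^ (q / 2))%:E)%E.
Proof.
move=> q2; have ab := regime_alpha1_bounds; have r0 := regime_r_gt0.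
have P1 := regime_P_ge1; have A0 := regime_A_ge.
have ab' : 0 <= alpha1 <= 1 / 2 by lra.
apply: le_trans (null_weight_powR_le delta01 ab' q2 z0 zE) _.
rewrite lee_fin TE.
have qd : 0 <= q - delta by move: d0; lra.
have h : P * (1 + z) `^ (q - delta) <= 16 * T `^ (q / 2).
  apply: (@le_trans _ _ (P * (4 `^ (q - delta) * T `^ ((q - delta) / 2)))).
    by rewrite ler_wpM2l ?powR_1z_le//; lra.
  have -> : T `^ (q / 2) = P * T `^ ((q - delta) / 2).
    rewrite PE -powRD; last by rewrite (gt_eqF T0) implybT.
    by congr (_ `^ _); lra.
  rewrite mulrCA ler_wpM2r ?mulr_ge0 ?powR_ge0//; first by lra.
  have -> : 16 = 4 `^ 2 :> R by rewrite powR_mulrn//; lra.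
  by apply: ler_powR; [lra|move: d0; lra].
have h2 : 1 <= T `^ (q / 2).
  have := @ler_powR R T T1 0 (q / 2); rewrite powRr0; apply.
  by move: d0; lra.
have Ar0 : 0 <= A * r by rewrite mulr_ge0//; lra.
have := ler_wpM2l Ar0 h; have := ler_wpM2l (ltW r0) h2.
rewrite alpha1E; lra.
Qed.

End null_coordinates.

(** * Pathwise bound and its expectation *)

Section pathwise.
Context {R : realType}.

(* [expR] of this quantity is at least 1 as soon as the estimated weight exceeds
   [alpha1], because the score at [alpha1] is then nonnegative. *)
Definition null_score delta alpha1 n (theta x : vec R n) : R :=
  \sum_(j < n | (tnth theta j : R) == 0) (slab_weight delta alpha1 (tnth x j) - alpha1).

Context (delta r T A P alpha1 : R).
Hypothesis delta01 : 0 < delta <= 1.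
Hypothesis T1 : 1 <= T.
Hypothesis TE : expR (- T) = r.
Hypothesis alpha1_01 : 0 <= alpha1 <= 1.
Hypothesis large : 5 + ln (4 / phi 1) + ln (2 / delta) <= T.

Let d0 : 0 < delta. Proof. by case/andP: delta01. Qed.
Let T0 : 0 < T. Proof. by apply: lt_le_trans T1. Qed.
Let r0 : 0 < r. Proof. by rewrite -TE expR_gt0. Qed.

Context (n : nat) (s q K lambda : R) (x theta : vec R n).
Hypothesis rs : r * n%:R = s.
Hypothesis q02 : 0 < q <= 2.
Hypothesis KE : K = 464 / phi 1.
Hypothesis lambda0 : 0 <= lambda.
Hypothesis sparse_theta : sparse n s theta.

(** The summand [s] pays for the signals, each of which contributes at most 1 to the full score. *)
Definition null_penalty : R := expR (lambda * (null_score delta alpha1 theta x + s)).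

(** The two terms of a null coordinate correspond to [alpha <= alpha1] and [alpha1 < alpha]; they
    are added rather than selected, which removes [alpha]. A signal keeps only its noise term: its
    part of order [T^(q / 2)] is summed pathwise in [posterior_risk_le]. *)
Definition coord_bound (i : 'I_n) : R :=
  if (tnth theta i : R) == 0 then
    2 * K * (slab_weight delta alpha1 (tnth x i) * (1 + `|tnth x i : R|) `^ q) +
    4 * K * ((1 + (tnth x i : R) ^+ 2) * null_penalty)
  else (8 + 4 * K) * (1 + ((tnth x i : R) - tnth theta i) ^+ 2).

Let K0 : 0 < K. Proof. by rewrite KE; apply: divr_gt0; rewrite ?ltr0n ?phi_gt0. Qed.

Let card_support_le :
  \sum_(i < n | (tnth theta i : R) != 0) 1 <= s :> R.
Proof.
move: sparse_theta; rewrite /sparse /=; apply: le_trans.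
by rewrite sumr_const cardsE.
Qed.

Lemma null_penalty_ge1 (alpha : R) : alpha1 < alpha -> alpha <= 1 ->
  log_marginal delta x alpha1 <= log_marginal delta x alpha -> 1 <= null_penalty.
Proof.
move=> a1a a1 h; have /andP[a10 _] := alpha1_01.
have := sum_slab_weight_ge0 d0 a10 a1a a1 h.
rewrite (bigID (fun j => (tnth theta j : R) == 0)) /= -/(null_score delta alpha1 theta x) => h0.
rewrite -[leLHS]expR0 ler_expR mulr_ge0//.
apply: le_trans h0 _; rewrite lerD2l; apply: le_trans card_support_le.
apply: ler_sum => i _; have /andP[_ w1] := slab_weight01 (tnth x i) d0 alpha1_01.
by rewrite lerBlDr (le_trans w1)// lerDl.
Qed.

Context (alpha0 alpha : R).
Hypothesis alpha0_le : 0 <= alpha0 <= alpha1.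
Hypothesis alpha_itv : alpha0 <= alpha <= 1.
Hypothesis alpha_max : forall beta, alpha0 <= beta <= 1 ->
  log_marginal delta x beta <= log_marginal delta x alpha.

Let alpha01 : 0 <= alpha <= 1.
Proof.
by move: alpha0_le alpha_itv => /andP[a b] /andP[c ->]; rewrite (le_trans a c).
Qed.

Let ratio i := marginal delta (tnth x i) / mixture delta alpha (tnth x i).

Let ratio_ge0 i : 0 <= ratio i.
Proof. by rewrite divr_ge0// ltW ?marginal_gt0 ?mixture_gt0. Qed.

Lemma null_coord_le i : (tnth theta i : R) == 0 ->
  (1 - slab_weight delta alpha (tnth x i)) * `|tnth theta i : R| `^ q +
  slab_weight delta alpha (tnth x i) *
    (2 * K * (1 + `|(tnth x i : R) - tnth theta i|) `^ q) <= coord_bound i.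
Proof.
(* Positivity of [q] matters here, as the power of 0 with exponent 0 is 1. *)
move=> ti; rewrite /coord_bound ti (eqP ti) normr0 powR0; last first.
  by rewrite gt_eqF//; case/andP: q02.
rewrite mulr0 add0r subr0.
have /andP[w0 w1] := slab_weight01 (tnth x i) d0 alpha01.
have /andP[v0 v1] := slab_weight01 (tnth x i) d0 alpha1_01.
have K0' := K0.
set D := (1 + `|_|) `^ q; have D0 : 0 <= D by exact: powR_ge0.
have x0 : 0 <= 1 + (tnth x i : R) ^+ 2 by rewrite addr_ge0// sqr_ge0.
have Z0 : 0 <= null_penalty by exact: expR_ge0.
have KD0 : 0 <= K * D by rewrite mulr_ge0// ltW.
have [le|lt] := leP alpha alpha1.
  have /andP[a0 _] := alpha01; have /andP[_ a1] := alpha1_01.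
  have := slab_weight_le (tnth x i) d0 a0 le a1 => h.
  have := ler_wpM2r KD0 h.
  have : 0 <= 4 * K * ((1 + (tnth x i : R) ^+ 2) * null_penalty).
    by rewrite !mulr_ge0// ltW.
  by lra.
have /andP[_ a1] := alpha_itv.
have Z1 : 1 <= null_penalty.
  apply: (null_penalty_ge1 lt a1); apply: alpha_max.
  by case/andP: alpha0_le => _ ->; case/andP: alpha1_01.
have hD : D <= 2 * (1 + (tnth x i : R) ^+ 2).
  by apply: powR_le_sqr; case/andP: q02 => /ltW -> ->.
have h1 : slab_weight delta alpha (tnth x i) * (K * D) <= K * D by rewrite ler_piMl.
have h2 : K * D <= K * (2 * (1 + (tnth x i : R) ^+ 2)) by rewrite ler_pM2l.
have h3 : K * (1 + (tnth x i : R) ^+ 2) <= K * ((1 + (tnth x i : R) ^+ 2) * null_penalty).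
  by rewrite ler_pM2l// ler_peMr.
have h4 : 0 <= slab_weight delta alpha1 (tnth x i) * (K * D) by rewrite mulr_ge0.
by lra.
Qed.

Lemma signal_coord_le i : (tnth theta i : R) != 0 ->
  (1 - slab_weight delta alpha (tnth x i)) * `|tnth theta i : R| `^ q +
  slab_weight delta alpha (tnth x i) *
    (2 * K * (1 + `|(tnth x i : R) - tnth theta i|) `^ q) <=
  T `^ (q / 2) * (36 + 16 * (r * ratio i)) + coord_bound i.
Proof.
move=> ti; rewrite /coord_bound (negbTE ti).
have /andP[w0 w1] := slab_weight01 (tnth x i) d0 alpha01.
have K0' := K0; have t1 := T1; have t0 := T0.
have lnr : ln r = - T by rewrite -TE expRK.
have := signal_weight_sqr_le delta01 (tnth x i) alpha01 r0 (ltW T0) lnr.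
rewrite -/(ratio i).
have y0 : 0 <= 1 - slab_weight delta alpha (tnth x i) by rewrite subr_ge0.
have y1 : 1 - slab_weight delta alpha (tnth x i) <= 1 by rewrite gerBl.
move: y0 y1; set y := 1 - _ => y0 y1.
set w := slab_weight _ _ _ in w0 w1 *.
set xi := tnth x i : R; set ti' := tnth theta i : R => h.
have q02' : 0 <= q <= 2 by case/andP: q02 => /ltW -> ->.
set D := (1 + `|xi - ti'|) `^ q.
have D0 : 0 <= D by exact: powR_ge0.
have hD : D <= 2 * (1 + (xi - ti') ^+ 2) by exact: powR_le_sqr.
have ht := norm_powR_dist_le xi ti' q02'.
have hx := norm_powR_le xi T0 q02'.
have TT0 : 0 <= T `^ (q / 2) by exact: powR_ge0.
set TT := T `^ (q / 2) in TT0 hx *.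
have hr : 0 <= r * ratio i by rewrite mulr_ge0// ltW.
set v := r * ratio i in h hr *.
(* By [large] the constants are at most [T], so [h] gives [y * xi ^ 2 <= 8 T + 4 v], and
   [v <= v * T]. *)
have h2 : y * (xi ^+ 2 / T) <= 8 + 4 * v.
  rewrite mulrA ler_pdivrMr//; apply: le_trans h _.
  have := ler_peMr hr t1; have := large; lra.
have h3 : y * `|xi| `^ q <= TT * (9 + 4 * v).
  apply: le_trans (ler_wpM2l y0 hx) _; rewrite mulrCA ler_wpM2l//.
  by rewrite mulrDr mulr1; lra.
have h4 := ler_wpM2l y0 ht.
have h5 : y * D <= D by rewrite ler_piMl.
have KD0 : 0 <= K * D by rewrite mulr_ge0// ltW.
have h6 : w * (K * D) <= K * D by rewrite ler_piMl.
have h7 : K * D <= K * (2 * (1 + (xi - ti') ^+ 2)) by rewrite ler_pM2l.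
have h8 : y * `|ti'| `^ q <= 4 * (y * `|xi| `^ q) + 4 * (y * D) by move: h4; rewrite -/D; lra.
lra.
Qed.

Lemma posterior_risk_le :
  (\int[posterior delta alpha x]_t (dq q t theta)%:E <=
   (52 * s * T `^ (q / 2))%:E + \sum_(i < n) (coord_bound i)%:E)%E.
Proof.
rewrite integral_posterior_dq sumEFin -EFinD.
pose c i := (1 - slab_weight delta alpha (tnth x i)) * `|tnth theta i : R| `^ q +
  slab_weight delta alpha (tnth x i) *
    (2 * K * (1 + `|(tnth x i : R) - tnth theta i|) `^ q).
have q02' : 0 <= q <= 2 by case/andP: q02 => /ltW -> ->.
apply: (@le_trans _ _ (\sum_(i < n) (c i)%:E)%E).
  apply: lee_sum => i _.
  exact: (coord_risk_le delta01 (tnth x i) (tnth theta i) alpha01 q02' KE).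
rewrite sumEFin lee_fin.
pose H i := if (tnth theta i : R) != 0 then T `^ (q / 2) * (36 + 16 * (r * ratio i)) else 0.
apply: (@le_trans _ _ (\sum_(i < n) (H i + coord_bound i))).
  apply: ler_sum => i _; rewrite /H /c; case: ifPn => ti.
    exact: signal_coord_le.
  by rewrite add0r null_coord_le// -[_ == _]negbK.
rewrite big_split /= lerD2r /H -big_mkcond /= -mulr_sumr big_split /= -!mulr_sumr.
rewrite mulrC ler_wpM2r ?powR_ge0//.
have h1 : \sum_(i < n | (tnth theta i : R) != 0) 36 <= 36 * s :> R.
  have -> : \sum_(i < n | (tnth theta i : R) != 0) 36 =
      36 * \sum_(i < n | (tnth theta i : R) != 0) 1 :> R.
    by rewrite mulr_sumr; apply: eq_bigr => i _; rewrite mulr1.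
  by rewrite ler_wpM2l// card_support_le.
(* Individual ratios are uncontrolled; only their sum is, through the first-order condition. Times
   [r] it is at most [s], whence [52 = 36 + 16]. *)
have h2 : \sum_(i < n | (tnth theta i : R) != 0) ratio i <= n%:R.
  apply: le_trans (sum_marginal_ratio_le d0 _ alpha_itv alpha_max); last first.
    by case/andP: alpha0_le.
  rewrite [leRHS](bigID (fun i => (tnth theta i : R) != 0)) /= lerDl.
  by apply: sumr_ge0 => i _; exact: ratio_ge0.
have := ler_wpM2l (ltW r0) h2; rewrite rs; lra.
Qed.

End pathwise.

(** * Expectation of the pathwise bound *)

Section expectation.
Context {R : realType}.
Local Notation RR := (measurableTypeR R).
Local Notation mu := (@lebesgue_measure R).

Lemma prode_le (I : finType) (F : I -> \bar R) (k : I -> R) :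
  (forall i, (0 <= F i <= (k i)%:E)%E) ->
  (\prod_(i : I) F i <= (\prod_(i : I) k i)%R%:E)%E.
Proof.
move=> Fk.
suff : (0 <= \prod_(i : I) F i <= (\prod_(i : I) k i)%R%:E)%E by case/andP.
elim/big_rec2 : _ => [|i y1 y2 _ /andP[h1 h2]]; first by rewrite lee_fin ler01 lexx.
have /andP[f0 fk] := Fk i.
by rewrite mule_ge0//= EFinM lee_pmul.
Qed.

Context (delta r T A P alpha1 : R).
Hypothesis delta01 : 0 < delta <= 1.
Hypothesis T1 : 1 <= T.
Hypothesis TE : expR (- T) = r.
Hypothesis PE : P = T `^ (delta / 2).
Hypothesis AE : A = 1024 / phi 1.
Hypothesis alpha1E : alpha1 = A * r * P.
Hypothesis small : 2 * A * r * P ^+ 2 <= phi 1 / 256.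
Hypothesis large : 1 <= 8 * delta * P.

Context (n : nat) (s q K lambda : R) (theta : vec R n).
Hypothesis rs : r * n%:R = s.
Hypothesis q2 : 2 * delta < q <= 2.
Hypothesis KE : K = 464 / phi 1.
Hypothesis lambdaE : lambda = (A * P)^-1.
Hypothesis sparse_theta : sparse n s theta.
Hypothesis s_ge1 : 1 <= s.
Hypothesis s_small : s + 1 <= n%:R / 4.
Hypothesis s_large : n%:R <= expR (lambda * s / 2).

Let d0 : 0 < delta. Proof. by case/andP: delta01. Qed.
Let r0 : 0 < r. Proof. by rewrite -TE expR_gt0. Qed.
Let K0 : 0 < K.
Proof. by rewrite KE; apply: divr_gt0; rewrite ?ltr0n ?phi_gt0. Qed.
Let A1 : 1024 <= A. Proof. exact: regime_A_ge AE. Qed.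
Let P1 : 1 <= P. Proof. exact: (regime_P_ge1 delta01 T1 PE). Qed.
Let AP : 1024 <= A * P.
Proof. by have a1 := A1; have p1 := P1; apply: (le_trans a1); rewrite ler_peMr//; lra. Qed.

Let alpha1_bounds : 0 < alpha1 <= 1 / 512.
Proof. exact: (regime_alpha1_bounds delta01 T1 TE PE AE alpha1E small). Qed.

Let alpha1_01 : 0 <= alpha1 <= 1. Proof. by have := alpha1_bounds; lra. Qed.

Let lambda_bounds : 0 < lambda <= 1 / 2.
Proof.
have ap := AP; rewrite lambdaE invr_gt0 div1r lef_pV2 ?posrE; lra.
Qed.

Let lambda_alpha1 : lambda * alpha1 = r.
Proof.
have a1 := A1; have p1 := P1; rewrite lambdaE alpha1E; field.
by rewrite !gt_eqF//; lra.
Qed.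

Local Notation b := (slab_weight delta alpha1).

Let mb : measurable_fun [set: RR] (b : RR -> R).
Proof. exact: measurable_slab_weight. Qed.

Let tilt (x : RR) : R := expR (lambda * (b x - alpha1)).

Let mtilt : measurable_fun [set: RR] tilt.
Proof.
apply: measurableT_comp => //; apply: measurable_funM => //.
exact: measurable_funB.
Qed.

Let m1sqr : measurable_fun [set: RR] (fun x : RR => 1 + (x : R) ^+ 2 : R).
Proof. by apply: measurable_funD => //; exact: measurable_funX. Qed.

Lemma tilt_le2 (x : RR) : tilt x <= 2.
Proof.
have l0 := lambda_bounds; have a0 := alpha1_bounds.
have /andP[w0 w1] := slab_weight01 (x : R) d0 alpha1_01.
apply: (@le_trans _ _ (expR lambda)).
  by rewrite ler_expR ler_piMr; lra.
apply: le_trans (expR_le_quadratic _) _; first by lra.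
have : lambda ^+ 2 <= (1 / 2) ^+ 2 by rewrite ler_sqr ?nnegrE; lra.
by rewrite expr2; lra.
Qed.

Lemma tilt_integral_le :
  (\int[normal_prob 0 1]_e (tilt e)%:E <= (expR (- (2 * lambda * r)))%:E)%E.
Proof.
apply: normal_mgf_le => //.
- by have := lambda_bounds; lra.
- exact: ltW.
- by rewrite lambda_alpha1.
- exact: (null_weight_regime delta01 T1 TE PE AE alpha1E small large).
Qed.

Let null j : bool := (tnth theta j : R) == 0.

Let penalized (i j : 'I_n) (x : RR) : R :=
  (if null j then tilt x else 1) * (if j == i then 1 + (x : R) ^+ 2 else 1).

Let measurable_penalized i j : measurable_fun [set: RR] (penalized i j).
Proof. by apply: measurable_funM; [case: (null j)|case: (j == i)]. Qed.

Let penalized_ge0 i j x : 0 <= penalized i j x.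
Proof.
rewrite mulr_ge0//; case: ifP => // _; first exact: expR_ge0.
by rewrite addr_ge0// sqr_ge0.
Qed.

Let penalizedE (i : 'I_n) (x : vec R n) :
  (1 + (tnth x i : R) ^+ 2) * null_penalty delta alpha1 s lambda x theta =
  expR (lambda * s) * \prod_(j < n) penalized i j (tnth x j).
Proof.
rewrite /null_penalty mulrDr expRD /null_score mulr_sumr expR_sum.
rewrite /penalized big_split /= -big_mkcond /= -big_mkcond /= big_pred1_eq.
by rewrite /tilt; ring.
Qed.

(** Each null coordinate other than [i] contributes a factor [expR (- 2 lambda r)], and there are at
    least [n - s - 1 >= 3 n / 4] of them. The exponent is thus at most [lambda s - 3 lambda s / 2 =
    - lambda s / 2], and [s_large] turns this into [1 / n], small enough to be summed over all
    coordinates. *)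
Lemma null_penalty_integral_le (i : 'I_n) : null i ->
  (\int[law_of_X theta]_x ((1 + (tnth x i : R) ^+ 2) *
     null_penalty delta alpha1 s lambda x theta)%:E <= (116 / n%:R)%:E)%E.
Proof.
move=> ni; have l0 := lambda_bounds; have s4 := s_small; have r0' := r0.
under eq_integral do rewrite penalizedE EFinM.
rewrite ge0_integralZl//; last 2 first.
- by apply/measurable_EFinP; exact: measurable_prod_tnth.
- by move=> x _; rewrite lee_fin prodr_ge0.
rewrite integral_law_of_X//.
pose rho := expR (- (2 * lambda * r)).
have rho0 : 0 < rho by exact: expR_gt0.
(* Coordinate [i] has only the bound [116 = 58 * 2]; writing it as [rho * (116 / rho)] lets it join
   the product over all null coordinates. *)
pose k (j : 'I_n) : R := (if null j then rho else 1) *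
  (if j == i then 116 / rho else 1).
have kle : (\prod_(j < n) \int[normal_prob 0 1]_e
    (penalized i j ((tnth theta j : R) + (e : R))%R)%:E <= (\prod_(j < n) k j)%R%:E)%E.
  apply: prode_le => j; apply/andP; split.
    by apply: integral_ge0 => e _; rewrite lee_fin.
  rewrite /penalized /k; have [->|ji] := eqVneq j i.
    rewrite ni (eqP ni) mulrCA divff ?gt_eqF// mulr1.
    under eq_integral do rewrite add0r.
    have -> : 116 = 58 * 2 :> R by lra.
    apply: integral_1Dsqr_le => //; first exact: measurable_funM.
    move=> x; rewrite mulr_ge0 ?expR_ge0 ?addr_ge0 ?sqr_ge0//=.
    by rewrite ler_wpM2r ?tilt_le2// addr_ge0// sqr_ge0.
  case: ifPn => nj.
    rewrite mulr1 (eqP nj); under eq_integral do rewrite add0r mulr1.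
    exact: tilt_integral_le.
  rewrite !mulr1 (@integral_cst _ _ _ (normal_prob 0 1) setT measurableT 1%E) mul1e.
  by rewrite [leLHS](_ : _ = 1%E)//; exact: probability_setT.
apply: le_trans (lee_wpmul2l _ kle) _; first by rewrite lee_fin expR_ge0.
rewrite -EFinM lee_fin /k big_split /= -big_mkcond /= -big_mkcond /= big_pred1_eq.
rewrite prodr_const.
have n0 : 0 < n%:R :> R by rewrite ltr0n (leq_ltn_trans _ (ltn_ord i)).
have card : n%:R - s <= (#|[pred j | null j]|)%:R.
  have := cardC [pred j : 'I_n | null j]; rewrite card_ord => cE.
  rewrite -[in n%:R]cE natrD lerBlDr lerD2l; apply: le_trans sparse_theta.
  rewrite ler_nat cardsE leq_eqVlt; apply/orP; left; apply/eqP.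
  by apply: eq_card => j; rewrite !inE.
move: card; set m : R := (#|[pred j | null j]|)%:R => card.
rewrite /rho -expRM_natl -expRN opprK.
have -> : expR (lambda * s) * (expR (m * - (2 * lambda * r)) * (116 * expR (2 * lambda * r)))
    = 116 * expR (lambda * s - 2 * lambda * (r * (m - 1))).
  have -> : lambda * s - 2 * lambda * (r * (m - 1)) =
      lambda * s + (m * - (2 * lambda * r) + 2 * lambda * r) by ring.
  by rewrite !expRD; ring.
rewrite ler_pM2l; last by lra.
rewrite -[leRHS]mul1r ler_pdivlMr//.
apply: (@le_trans _ _ (expR (lambda * s - 2 * lambda * (r * (m - 1))) *
    expR (lambda * s / 2))); first by rewrite ler_wpM2l ?expR_ge0.
rewrite -expRD -[leRHS]expR0 ler_expR.
have h : 3 / 4 * s <= r * (m - 1).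
  rewrite -rs mulrCA; apply: ler_wpM2l; first exact: ltW.
  by lra.
have l0' : 0 <= lambda by lra.
by have := ler_wpM2l l0' h; lra.
Qed.


Local Notation bound x i := (coord_bound delta alpha1 s q K lambda x theta i).

Let weighted (x : RR) : R := b x * (1 + `|x : R|) `^ q.

Let mweighted : measurable_fun [set: RR] weighted.
Proof.
apply: measurable_funM => //.
have m1 : measurable_fun [set: RR] (fun x : RR => 1 + `|x : R| : RR).
  by apply: measurable_funD => //; exact: measurableT_comp.
exact: measurableT_comp (measurable_powR q) m1.
Qed.

Let weighted_ge0 x : 0 <= weighted x.
Proof.
have /andP[w0 w1] := slab_weight01 (x : R) d0 alpha1_01.
by rewrite mulr_ge0// powR_ge0.
Qed.

Let measurable_penalty (i : 'I_n) : measurable_fun [set: vec R n]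
  (fun x : vec R n => (1 + (tnth x i : R) ^+ 2) *
     null_penalty delta alpha1 s lambda x theta).
Proof.
rewrite (_ : (fun x : vec R n => _) = (fun x => expR (lambda * s) *
    \prod_(j < n) penalized i j (tnth x j))); last first.
  by apply/funext => x; exact: penalizedE.
by apply: measurable_funM => //; exact: measurable_prod_tnth.
Qed.

Let penalty_ge0 (i : 'I_n) (x : vec R n) : 0 <= (1 + (tnth x i : R) ^+ 2) *
  null_penalty delta alpha1 s lambda x theta.
Proof. by rewrite mulr_ge0 ?expR_ge0// addr_ge0// sqr_ge0. Qed.

Lemma measurable_coord_bound (i : 'I_n) :
  measurable_fun [set: vec R n] (fun x : vec R n => bound x i).
Proof.
rewrite /coord_bound; case: ((tnth theta i : R) == 0); last first.
  apply: measurable_funM => //; apply: measurable_funD => //.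
  apply: measurable_funX; apply: measurable_funB => //; exact: measurable_tnth.
apply: measurable_funD; apply: measurable_funM => //.
exact: measurableT_comp mweighted (measurable_tnth _).
Qed.

Lemma coord_bound_ge0 (i : 'I_n) (x : vec R n) : 0 <= bound x i.
Proof.
have k0 := K0; rewrite /coord_bound; case: ifP => _.
  apply: addr_ge0; apply: mulr_ge0 => //; [lra|exact: weighted_ge0|lra].
by apply: mulr_ge0; [lra|rewrite addr_ge0// sqr_ge0].
Qed.

Lemma null_coord_bound_integral_le (i : 'I_n) : null i ->
  (\int[law_of_X theta]_x (bound x i)%:E <=
   (2 * K * ((3712 * A + 16) * r * T `^ (q / 2)) + 4 * K * (116 / n%:R))%:E)%E.
Proof.
move=> ni; have k0 := K0.
have k2 : 0 <= 2 * K by lra.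
have k4 : 0 <= 4 * K by lra.
have ni' : (tnth theta i : R) == 0 by [].
rewrite (eq_integral (fun x : vec R n => (2 * K)%:E * (weighted (tnth x i))%:E +
  (4 * K)%:E * ((1 + (tnth x i : R) ^+ 2) *
     null_penalty delta alpha1 s lambda x theta)%:E)%E); last first.
  by move=> x _; rewrite /coord_bound ni' EFinD !EFinM.
have m1 : measurable_fun [set: vec R n] (fun x : vec R n => (weighted (tnth x i))%:E).
  by apply/measurable_EFinP; exact: measurableT_comp mweighted (measurable_tnth _).
have m2 : measurable_fun [set: vec R n] (fun x : vec R n => ((1 + (tnth x i : R) ^+ 2) *
     null_penalty delta alpha1 s lambda x theta)%:E).
  exact/measurable_EFinP.
rewrite ge0_integralD//; last 4 first.
- by move=> x _; rewrite -EFinM lee_fin mulr_ge0.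
- exact: measurable_funeM.
- by move=> x _; rewrite -EFinM lee_fin mulr_ge0.
- exact: measurable_funeM.
rewrite [leRHS]EFinD; apply: leeD.
  rewrite ge0_integralZl//; last by move=> x _; rewrite lee_fin.
  rewrite [leRHS]EFinM lee_wpmul2l ?lee_fin//.
  rewrite integral_law_of_X1// (eqP ni'); under eq_integral do rewrite add0r.
  rewrite normal_integral//.
  exact: (null_weight_powR_regime delta01 T1 TE PE AE alpha1E small q2).
rewrite ge0_integralZl//; last by move=> x _; rewrite lee_fin.
by rewrite [leRHS]EFinM lee_wpmul2l ?lee_fin// null_penalty_integral_le.
Qed.

Lemma signal_coord_bound_integral_le (i : 'I_n) : ~~ null i ->
  (\int[law_of_X theta]_x (bound x i)%:E <= (58 * (8 + 4 * K))%:E)%E.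
Proof.
move=> ni; have k0 := K0; have k8 : 0 <= 8 + 4 * K by lra.
have ni' : ((tnth theta i : R) == 0) = false by apply/negbTE.
pose h (u : RR) : R := (8 + 4 * K) * (1 + ((u : R) - tnth theta i) ^+ 2).
have mh : measurable_fun [set: RR] h.
  apply: measurable_funM => //; apply: measurable_funD => //.
  by apply: measurable_funX; apply: measurable_funB.
have h0 u : 0 <= h u by rewrite mulr_ge0// addr_ge0// sqr_ge0.
rewrite (eq_integral (fun x : vec R n => (h (tnth x i))%:E)); last first.
  by move=> x _; rewrite /coord_bound ni'.
rewrite integral_law_of_X1//; apply: integral_1Dsqr_le => //.
  exact: measurableT_comp mh (measurable_shift _).
by move=> x; rewrite h0 /h [_ - tnth theta i]addrAC subrr add0r lexx.
Qed.

Lemma total_bound_integral_le :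
  (\int[law_of_X theta]_x ((52 * s * T `^ (q / 2))%:E + \sum_(i < n) (bound x i)%:E) <=
   ((52 + 58 * (8 + 4 * K) + 2 * K * (3712 * A + 16) + 464 * K) *
     s * T `^ (q / 2))%:E)%E.
Proof.
have k0 := K0; have a1 := A1; have r0' := r0.
have TT1 : 1 <= T `^ (q / 2).
  have := @ler_powR R T T1 0 (q / 2); rewrite powRr0; apply.
  by have := d0; move: q2; lra.
have card0 : \sum_(i < n | ~~ null i) 1 <= s :> R.
  by move: sparse_theta; rewrite /sparse /=; apply: le_trans; rewrite sumr_const cardsE.
have s0 : 0 <= s by apply: le_trans card0; exact: sumr_ge0.
have TT0 : 0 <= T `^ (q / 2) by exact: powR_ge0.
set TT := T `^ (q / 2) in TT0 TT1 *.
rewrite ge0_integralD//; last 3 first.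
- by move=> x _; rewrite lee_fin mulr_ge0// mulr_ge0.
- by move=> x _; apply: sume_ge0 => i _; rewrite lee_fin coord_bound_ge0.
- by apply: emeasurable_sum => i; apply/measurable_EFinP; exact: measurable_coord_bound.
have -> : (\int[law_of_X theta]_x (52 * s * TT)%:E = (52 * s * TT)%:E)%E.
  rewrite (@integral_cst _ _ _ (law_of_X theta) setT measurableT (52 * s * TT)%:E).
  by rewrite -[RHS]mule1; congr (_ * _)%E; exact: probability_setT.
rewrite ge0_integral_sum//; last 2 first.
- by move=> i; apply/measurable_EFinP; exact: measurable_coord_bound.
- by move=> i x _; rewrite lee_fin coord_bound_ge0.
pose k i := (if null i then 2 * K * ((3712 * A + 16) * r * TT) + 4 * K * (116 / n%:R)
  else 0) + (if ~~ null i then 58 * (8 + 4 * K) else 0).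
apply: (@le_trans _ _ ((52 * s * TT)%:E + \sum_(i < n) (k i)%:E)%E).
  rewrite leeD2l//; apply: lee_sum => i _; rewrite /k; case: ifPn => ni.
    by rewrite addr0 null_coord_bound_integral_le.
  by rewrite add0r signal_coord_bound_integral_le.
rewrite sumEFin -EFinD lee_fin /k big_split /=.
set N := 2 * K * _ + _.
have N0 : 0 <= N.
  rewrite /N; apply: addr_ge0; apply: mulr_ge0; [lra| |lra|by apply: divr_ge0; rewrite ?ler0n].
  apply: mulr_ge0; last exact: TT0.
  by apply: mulr_ge0; [lra|exact: ltW].
have h1 : \sum_(i < n) (if null i then N else 0) <= n%:R * N.
  apply: (@le_trans _ _ (\sum_(i < n) N)).
    by apply: ler_sum => i _; case: ifP.
  by rewrite sumr_const card_ord mulr_natl.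
have h2 : \sum_(i < n) (if ~~ null i then 58 * (8 + 4 * K) else 0) <= 58 * (8 + 4 * K) * s.
  rewrite -big_mkcond /=.
  have -> : \sum_(i < n | ~~ null i) (58 * (8 + 4 * K)) =
      58 * (8 + 4 * K) * \sum_(i < n | ~~ null i) 1.
    by rewrite mulr_sumr; apply: eq_bigr => i _; rewrite mulr1.
  by apply: ler_wpM2l => //; lra.
have n0 : 0 < n%:R :> R by have := s_small; have := s_ge1; lra.
(* Here [r * n = s] produces the rate, while the penalties add up to the constant [464 K], absorbed
   because [1 <= s * TT]. *)
have eN : n%:R * N = 2 * K * ((3712 * A + 16) * (s * TT)) + 464 * K.
  by rewrite /N -rs; field; rewrite gt_eqF.
have hs : s <= s * TT by rewrite ler_peMr.
have hs1 : 1 <= s * TT by apply: le_trans hs; exact: s_ge1.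
have k464 : 0 <= 464 * K by lra.
have h3 := ler_peMr k464 hs1.
have h4 : 58 * (8 + 4 * K) * s <= 58 * (8 + 4 * K) * (s * TT).
  by apply: ler_wpM2l => //; lra.
have : 52 * s * TT = 52 * (s * TT) by ring.
move: h1 h2; rewrite eN; lra.
Qed.

End expectation.

(** * Risk bound at a fixed sample size *)

Section fixed_sample_size.
Context {R : realType}.
Local Notation RR := (measurableTypeR R).

Definition level (delta s : R) (n : nat) : R :=
  1024 / phi 1 * (s / n%:R) * ln (n%:R / s) `^ (delta / 2).

(** Collects what is asked of a large [n]. Neither [q] nor [theta] occurs, so a single rank serves
    all of them, and [delta] affects this rank but not the constant of the risk bound. *)
Definition regime (delta s : R) (n : nat) : Prop :=
  let T := ln (n%:R / s) in let P := T `^ (delta / 2) in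
  let A := 1024 / phi 1 in let t := Num.sqrt (2 * ln n%:R) in
  [/\ 1 <= s, s + 1 <= n%:R / 4, 1 <= T,
      5 + ln (4 / phi 1) + ln (2 / delta) <= T &
      [/\ 2 * A * (s / n%:R) * P ^+ 2 <= phi 1 / 256, 1 <= 8 * delta * P,
          n%:R <= expR ((A * P)^-1 * s / 2), 3 * (1 + t) ^+ 2 <= 16 * s &
          1 <= t /\ 3712 / phi 1 <= 1 + (t - 1) ^+ 2]].

Context (delta s : R) (n : nat).
Hypothesis delta01 : 0 < delta <= 1.
Hypothesis reg : regime delta s n.

Let d0 : 0 < delta. Proof. by case/andP: delta01. Qed.

Let s0 : 0 < s. Proof. by case: reg => s1 _ _ _ _; lra. Qed.

Let n0 : 0 < n%:R :> R. Proof. by case: reg => s1 sn _ _ _; lra. Qed.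

Let ratio_ln : expR (- ln (n%:R / s)) = s / n%:R.
Proof. by rewrite -lnV ?posrE ?divr_gt0// lnK ?posrE ?invr_gt0 ?divr_gt0// invf_div. Qed.

Lemma level_bounds : 0 < level delta s n <= 1 / 512.
Proof.
case: reg => s1 sn T1 T2 [sm la _ _ _].
exact: (regime_alpha1_bounds delta01 T1 ratio_ln erefl erefl erefl sm).
Qed.

(** At [t = sqrt (2 ln n)] the median is 0. There [phi t <= 1 / n], whereas [level * g t] is at
    least of order [(s / n) / (1 + t)^2], larger because [s] dominates [ln n]. If [a] exceeded
    [level], monotonicity would give weight at least 3/4 at [t], hence a median at least 1. *)
Lemma threshold_le_level (a : R) : 0 <= a <= 1 ->
  is_threshold delta a (Num.sqrt (2 * ln n%:R)) -> a <= level delta s n.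
Proof.
move=> a01 [t0 /(_ (Num.sqrt (2 * ln n%:R)))[_]].
rewrite ger0_norm ?sqrtr_ge0// => /(_ (lexx _)) med.
rewrite leNgt; apply/negP => la.
case: reg => s1 sn T1 T2 [sm lar _ tsmall [t1 tbig]].
have lb := level_bounds.
set t := Num.sqrt _ in t0 med tsmall t1 tbig.
have l01 : 0 <= level delta s n <= 1 by lra.
suff w34 : 3 / 4 <= slab_weight delta a t.
  have := posterior_median_ge1 delta01 a01 t1 w34 tbig.
  by rewrite med; lra.
apply: (@le_trans _ _ (slab_weight delta (level delta s n) t)); last first.
  by apply: slab_weight_le => //; lra.
apply: slab_weight_ge => //; first by lra.
have phit : phi t <= n%:R^-1.
  rewrite phiE sqr_sqrtr; last first.
    by rewrite mulr_ge0// ln_ge0// ler1n -(ltr0n R).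
  rewrite mulrAC divff// mul1r expRN lnK ?posrE//.
  by rewrite ler_piMl ?normal_peak1_le1// invr_ge0 ltW.
have sl : slab delta 0 <= (1 + t) ^+ 2 * slab delta t.
  by apply: slab_le_ratio => //; rewrite ?normr0 ?addr0 ?mulr1 ?(gtr0_norm t0)//; lra.
have s0E : slab delta 0 = delta / 2.
  by rewrite /slab /slab_shape normr0 addr0 powR1 mulr1 slab_constE.
have gt := slab_le_marginal delta01 t.
have y0 : 0 < (1 + t) ^+ 2 by rewrite exprn_gt0// addr_gt0.
have p1 := @phi_gt0 R 1.
have h1 : 3 * phi t * (1 + t) ^+ 2 <= 16 * (s / n%:R).
  apply: (@le_trans _ _ (3 * (1 + t) ^+ 2 * n%:R^-1)).
    by rewrite mulrAC ler_wpM2l//; lra.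
  by rewrite [leRHS]mulrA ler_wpM2r// invr_ge0 ltW.
have aP : 16 * (s / n%:R) <= level delta s n * (phi 1 / 4 * (delta / 2)).
  have -> : level delta s n * (phi 1 / 4 * (delta / 2)) =
      16 * (s / n%:R) * (8 * delta * ln (n%:R / s) `^ (delta / 2)).
    by rewrite /level; field; rewrite !gt_eqF.
  by rewrite ler_peMr// mulr_ge0// divr_ge0// ltW.
have h2 : 3 * phi t * (1 + t) ^+ 2 <= level delta s n * marginal delta t * (1 + t) ^+ 2.
  apply: (le_trans h1); apply: (le_trans aP); rewrite -s0E.
  rewrite -[leRHS]mulrA ler_pM2l; last by lra.
  apply: (@le_trans _ _ (phi 1 / 4 * ((1 + t) ^+ 2 * slab delta t))).
    by rewrite ler_pM2l// divr_gt0.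
  by rewrite mulrCA mulrC ler_pM2r.
move: h2; rewrite ler_pM2r// => h2.
have pt := phi_gt0 t.
have : (1 - level delta s n) * phi t <= phi t by rewrite ler_piMl ?ltW//; lra.
by lra.
Qed.

Lemma posterior_risk_expectation_le (a q : R) (hat : vec R n -> R) (theta : vec R n) :
  0 <= a <= 1 -> is_threshold delta a (Num.sqrt (2 * ln n%:R)) ->
  is_mmle delta a hat -> 2 * delta < q <= 2 -> sparse n s theta ->
  (\int[law_of_X theta]_X \int[posterior delta (hat X) X]_t (dq q t theta)%:E <=
   ((52 + 58 * (8 + 4 * (464 / phi 1)) +
     2 * (464 / phi 1) * (3712 * (1024 / phi 1) + 16) + 464 * (464 / phi 1)) *
    s * ln (n%:R / s) `^ (q / 2))%:E)%E.
Proof.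
move=> a01 thr [_ mmle] q2 sp; have al := threshold_le_level a01 thr.
case: reg => s1 sn T1 T2 [sm lar slarge _ _].
have lb := level_bounds; have l01 : 0 <= level delta s n <= 1 by lra.
have rs : s / n%:R * n%:R = s by rewrite divfK// gt_eqF.
apply: le_trans (total_bound_integral_le delta01 T1 ratio_ln erefl erefl erefl
  sm lar rs q2 erefl erefl sp s1 sn slarge).
apply: ge0_le_integralT => X.
  apply: integral_ge0 => t _; rewrite lee_fin; apply: sumr_ge0 => i _.
  exact: powR_ge0.
have [hatI hatM] := mmle X.
have q02 : 0 < q <= 2 by have := d0; lra.
have a0l : 0 <= a <= level delta s n by rewrite al andbT; case/andP: a01.
apply: (posterior_risk_le delta01 T1 ratio_ln l01 T2 rs q02 erefl _ sp a0l hatI hatM).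
rewrite invr_ge0; apply: mulr_ge0; last exact: powR_ge0.
by apply: divr_ge0; [exact: ler0n|exact: phi_ge0].
Qed.

End fixed_sample_size.

(** * The asymptotic regime *)

Section asymptotic_regime.
Context {R : realType}.

Lemma sqr_le_expR (T : R) : 0 <= T -> T ^+ 2 / 4 <= expR T.
Proof.
move=> T0; have -> : expR T = expR (T / 2) ^+ 2 by rewrite -expRM_natl; congr expR; lra.
have -> : T ^+ 2 / 4 = (T / 2) ^+ 2 by rewrite exprMn; lra.
rewrite ler_sqr ?nnegrE ?expR_ge0 ?divr_ge0//.
by apply: le_trans (expR_ge1Dx _); lra.
Qed.

Lemma powR_half_sqr_le (delta T : R) : 0 < delta <= 1 -> 1 <= T ->
  (T `^ (delta / 2)) ^+ 2 <= T.
Proof.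
move=> d01 T1; rewrite expr2 -powRD; last first.
  by rewrite (gt_eqF (lt_le_trans ltr01 T1)) implybT.
rewrite -[leRHS]powRr1; last by rewrite (le_trans ler01).
by apply: ler_powR => //; lra.
Qed.

Lemma small_of_large_T (A p T P : R) : 0 <= A -> 0 <= p -> 1 <= T -> P ^+ 2 <= T ->
  2048 * A <= T * p -> 2 * A * expR (- T) * P ^+ 2 <= p / 256.
Proof.
move=> A0 p0 T1 P2 c3T; have T0 : 0 <= T by rewrite (le_trans ler01).
rewrite expRN mulrAC ler_pdivrMr ?expR_gt0//.
apply: (@le_trans _ _ (2 * A * T)); first by rewrite ler_wpM2l ?mulr_ge0.
apply: (@le_trans _ _ (p / 256 * (T ^+ 2 / 4))); last first.
  by apply: ler_wpM2l (sqr_le_expR T0); lra.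
by have := ler_wpM2r T0 c3T; rewrite expr2; lra.
Qed.

(** The condition on [T] is severe for small [delta], but [delta] is fixed before [n]. *)
Lemma large_of_large_T (delta T : R) : 0 < delta ->
  (8 * delta)^-1 `^ (2 / delta) <= T -> 1 <= 8 * delta * T `^ (delta / 2).
Proof.
move=> d0 wT; have d8 : 0 < 8 * delta by rewrite mulr_gt0.
rewrite -ler_pdivrMl// mulr1.
have -> : (8 * delta)^-1 = ((8 * delta)^-1 `^ (2 / delta)) `^ (delta / 2).
  rewrite -powRrM (_ : 2 / delta * (delta / 2) = 1) ?powRr1 ?invr_ge0 ?(ltW d8)//.
  by field; rewrite gt_eqF.
apply: ge0_ler_powR; rewrite ?nnegrE ?powR_ge0//; first by rewrite divr_ge0// ltW.
exact: le_trans (powR_ge0 _ _) wT.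
Qed.

(** With [L = ln n], this is where [kappa1 ln^2 n <= s] makes the bad event negligible: [P] is at
    most the square root of [L], so [s / (A P)] is at least of order [L^(3/2)] and eventually
    exceeds [2 L]. *)
Lemma exponent_of_large_s (A P kappa L s : R) : 0 < A -> 0 < P -> 0 < kappa ->
  0 <= L -> P ^+ 2 <= L -> (2 * A / kappa) ^+ 2 <= L -> kappa * L ^+ 2 <= s ->
  L <= (A * P)^-1 * s / 2.
Proof.
move=> A0 P0 k0 L0 PL AL ks.
rewrite ler_pdivlMr// mulrC ler_pdivlMl ?mulr_gt0//.
apply: le_trans ks; rewrite expr2.
have kL : 2 * A * P <= kappa * L.
  rewrite -ler_sqr ?nnegrE ?mulr_ge0 ?(ltW A0) ?(ltW P0) ?(ltW k0)//.
  rewrite exprMn [leRHS]exprMn; apply: (@le_trans _ _ ((2 * A) ^+ 2 * L)).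
    by rewrite ler_wpM2l ?sqr_ge0.
  move: AL; rewrite exprMn exprVn ler_pdivrMr ?exprn_gt0// => h.
  by rewrite [L ^+ 2]expr2 mulrA ler_wpM2r// [leRHS]mulrC.
by have := ler_wpM2r L0 kL; lra.
Qed.

Lemma threshold_of_large_s (kappa L s t : R) : 0 < kappa -> 1 <= L ->
  2 / kappa <= L -> kappa * L ^+ 2 <= s -> t ^+ 2 = 2 * L ->
  3 * (1 + t) ^+ 2 <= 16 * s.
Proof.
move=> k0 L1 kL ks t2; have := sqr_ge0 (1 - t); have L0 : 0 <= L by lra.
have kL' : 2 <= kappa * L by rewrite mulrC -ler_pdivrMr.
by have := ler_wpM2r L0 kL'; move: ks t2; rewrite !expr2; lra.
Qed.

Lemma sqr_of_large_threshold (c t : R) : 1 <= c -> 1 + c <= t ->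
  1 <= t /\ c <= 1 + (t - 1) ^+ 2.
Proof.
move=> c1 ct; split; first by lra.
apply: (@le_trans _ _ (1 + c * c)).
  by apply: (@le_trans _ _ (c * c)); [rewrite ler_peMr//; lra|rewrite lerDr].
by rewrite lerD2l expr2; apply: ler_pM; lra.
Qed.

Lemma le_of_sum_le (a b c x : R) : 0 <= a -> 0 <= b -> 0 <= c ->
  1 + a + b + c <= x -> [/\ 1 <= x, a <= x, b <= x & c <= x].
Proof. by move=> *; split; lra. Qed.

(** The requirements on [T = ln (n / s)] and on [ln n] are each packed into one sum of nonnegative
    terms, so that two inequalities yield them all. *)
Lemma regime_intro (delta s kappa : R) (n : nat) : 0 < delta <= 1 ->
  0 < kappa -> 1 <= s -> 8 <= n%:R :> R -> s / n%:R <= 1 / 8 ->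
  s / n%:R <= expR (- (1 + `|5 + ln (4 / phi 1) + ln (2 / delta)| +
    2048 * (1024 / phi 1) / phi 1 + (8 * delta)^-1 `^ (2 / delta))) ->
  1 + (2 * (1024 / phi 1) / kappa) ^+ 2 + 2 / kappa + (1 + 3712 / phi 1) ^+ 2 <=
    ln n%:R ->
  kappa * ln n%:R ^+ 2 <= s -> regime delta s n.
Proof.
move=> d01 k0 s1 n8 sn8 snM LM ks.
have p1 := @phi_gt0 R 1.
have d0 : 0 < delta by case/andP: d01.
have s0 : 0 < s by exact: lt_le_trans s1.
have n0 : 0 < n%:R :> R by exact: lt_le_trans n8.
have TE : expR (- ln (n%:R / s)) = s / n%:R.
  by rewrite -lnV ?posrE ?divr_gt0// lnK ?posrE ?invr_gt0 ?divr_gt0// invf_div.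
have LE : expR (ln n%:R) = n%:R :> R by rewrite lnK ?posrE.
have TL : ln (n%:R / s) <= ln n%:R.
  by rewrite ler_ln ?posrE ?divr_gt0// ler_pdivrMr// ler_peMr// ltW.
have A1 : 1 <= 1024 / phi 1 :> R.
  by rewrite ler_pdivlMr//; have := @phi_le1 R 1; lra.
have c1 : 1 <= 3712 / phi 1 :> R.
  by rewrite ler_pdivlMr//; have := @phi_le1 R 1; lra.
have sn : s + 1 <= n%:R / 4 by move: sn8; rewrite ler_pdivrMr//; lra.
have p0 := ltW p1.
have c0 : 0 <= 2048 * (1024 / phi 1) / phi 1 :> R.
  apply: divr_ge0; last exact: p0.
  by apply: mulr_ge0; [exact: ler0n|exact: le_trans A1].
rewrite -TE ler_expR lerN2 in snM.
have [T1 c2T c3T wT] := le_of_sum_le (normr_ge0 _) c0 (powR_ge0 _ _) snM.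
have k2 : 0 <= 2 / kappa by rewrite divr_ge0// ltW.
have [L1 AL kL cL] := le_of_sum_le (sqr_ge0 _) k2 (sqr_ge0 _) LM.
have P2 := powR_half_sqr_le d01 T1.
have L0 : 0 <= ln n%:R :> R by exact: le_trans L1.
have A0 : 0 < 1024 / phi 1 :> R by exact: lt_le_trans A1.
have P0 : 0 < ln (n%:R / s) `^ (delta / 2) by rewrite powR_gt0// (lt_le_trans _ T1).
have t2 : Num.sqrt (2 * ln n%:R) ^+ 2 = 2 * ln n%:R :> R by rewrite sqr_sqrtr// mulr_ge0.
have c0' : 0 <= 1 + 3712 / phi 1 :> R by apply: addr_ge0; [exact: ler01|exact: le_trans c1].
have ct : 1 + 3712 / phi 1 <= Num.sqrt (2 * ln n%:R) :> R.
  rewrite -(ger0_norm c0') -sqrtr_sqr ler_wsqrtr//; apply: (le_trans cL).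
  by rewrite mulrDl mul1r lerDl.
split; [exact: s1|exact: sn|exact: T1|exact: le_trans (ler_norm _) c2T|split].
- rewrite -TE; apply: (small_of_large_T (ltW A0) p0 T1 P2).
  by rewrite -(ler_pdivrMr _ _ p1).
- exact: large_of_large_T.
- rewrite -[leLHS]LE ler_expR.
  exact: (exponent_of_large_s A0 P0 k0 L0 (le_trans P2 TL) AL ks).
- exact: (threshold_of_large_s k0 L1 kL ks t2).
- exact: sqr_of_large_threshold.
Qed.

Lemma near_regime (delta kappa : R) (s : nat -> R) : 0 < delta <= 1 ->
  (fun n => s n / n%:R) @ \oo --> (0 : R) -> s @ \oo --> +oo -> 0 < kappa ->
  (\forall n \near \oo, kappa * ln n%:R ^+ 2 <= s n) ->
  \forall n \near \oo, regime delta (s n) n.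
Proof.
move=> d01 /cvgr0Pnorm_lt snr /cvgryPge sy k0 ks.
near=> n; apply: (@regime_intro _ _ kappa) => //.
- by near: n; exact: sy.
- by near: n; exact: nbhs_infty_ger.
- apply: ltW; apply: le_lt_trans (ler_norm _) _.
  by near: n; apply: snr; rewrite divr_gt0.
- apply: ltW; apply: le_lt_trans (ler_norm _) _.
  by near: n; apply: snr; exact: expR_gt0.
- set M := (X in X <= _).
  have Mn : expR M <= n%:R by near: n; exact: nbhs_infty_ger.
  rewrite -[leLHS]expRK ler_ln ?posrE ?expR_gt0//.
  exact: lt_le_trans (expR_gt0 _) Mn.
- by near: n.
Unshelve. all: by end_near. Qed.

End asymptotic_regime.

Theorem theorem1 (R : realType) :
  exists C : R, 0 < C /\
    forall (delta : R) (s : nat -> R) (kappa1 : R)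
      (alpha_ : nat -> R) (alpha_hat : forall n, vec R n -> R),
      0 < delta < 2 ->
      (fun n => s n / n%:R) @ \oo --> (0 : R) ->
      s @ \oo --> +oo ->
      0 < kappa1 ->
      (\forall n \near \oo, kappa1 * ln n%:R ^+ 2 <= s n) ->
      (forall n, (1 < n)%N ->
        0 <= alpha_ n <= 1 /\
        is_threshold delta (alpha_ n) (Num.sqrt (2 * ln n%:R))) ->
      (forall n, (1 < n)%N -> is_mmle delta (alpha_ n) (alpha_hat n)) ->
      exists N : nat, forall n : nat, (N <= n)%N ->
      forall q : R, 2 * delta < q <= 2 ->
        (ereal_sup
           [set \int[law_of_X theta0]_X
                  \int[posterior delta (alpha_hat n X) X]_theta
                    (dq q theta theta0)%:E | theta0 in sparse n (s n)]
         <= (C * s n * ln (n%:R / s n) `^ (q / 2))%R%:E)%E.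
Proof.
(* Chosen before [delta], [s] and [q]: only numerals and [phi 1] enter. *)
exists (52 + 58 * (8 + 4 * (464 / phi 1)) +
     2 * (464 / phi 1) * (3712 * (1024 / phi 1) + 16) + 464 * (464 / phi 1)).
split.
  have p1 := @phi_gt0 R 1.
  have k0 : 0 < 464 / phi 1 :> R by apply: divr_gt0; rewrite ?ltr0n.
  have a0 : 0 < 1024 / phi 1 :> R by apply: divr_gt0; rewrite ?ltr0n.
  have := mulr_gt0 k0 a0; lra.
move=> delta s kappa alpha_ hat d02 snr sy k0 ks thr mmle.
(* For [delta > 1] no [q] satisfies [2 * delta < q <= 2]. *)
have [d1|d1] := leP delta 1; last by exists 0%N => n _ q q2; exfalso; lra.
have d01 : 0 < delta <= 1 by lra.
have [N _ hN] := near_regime d01 snr sy k0 ks.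
exists (maxn N 2) => n; rewrite geq_max => /andP[Nn n2] q q2.
apply: ge_ereal_sup => _ [theta sp <-].
have [a01 th] := thr n n2.
exact: (posterior_risk_expectation_le d01 (hN n Nn) a01 th (mmle n n2) q2 sp).
Qed.
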